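(* Let $M$ be a pointed metric space. Then the Lipschitz-free space $\mathcal{F}(M)$ is the strongly unique isometric predual of the Lipschitz space $\mathrm{Lip}_0(M)$; that is, for every Banach space $F$ and every surjective linear isometry $T:\mathrm{Lip}_0(M)\to F^*$, the map $T$ is continuous from the topology $\sigma(\mathrm{Lip}_0(M),\mathcal{F}(M))$ to the topology $\sigma(F^*,F)$.
   Context: All Banach spaces are real. A pointed metric space is a metric space $(M,d)$ with a distinguished base point $0\in M$. $\mathrm{Lip}_0(M)$ is the Banach space of all Lipschitz functions $f:M\to\mathbb{R}$ with $f(0)=0$, with norm $\|f\|_L=\sup\{(f(x)-f(y))/d(x,y): x\neq y\in M\}$ (equal to $0$ if $M$ is a singleton). For $x\in M$, $\delta(x)\in \mathrm{Lip}_0(M)^*$ is the evaluation functional $f\mapsto f(x)$, and $\mathcal{F}(M)$ is the norm-closed linear span of $\{\delta(x):x\in M\}$ in $\mathrm{Lip}_0(M)^*$. It is a standard fact that $\mathcal{F}(M)^*$ is canonically isometric to $\mathrm{Lip}_0(M)$ via the evaluation $f\mapsto[\mu\mapsto\mu(f)]$; the topology $\sigma(\mathrm{Lip}_0(M),\mathcal{F}(M))$ is the corresponding weak$^*$ topology. *)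

(* Defs.v *)
From HB Require Import structures.
From mathcomp Require Import all_boot all_order all_algebra.
From mathcomp Require Import all_classical all_reals all_analysis.
Import Order.TTheory GRing.Theory Num.Theory.
Import numFieldNormedType.Exports.

Set Implicit Arguments.
Unset Strict Implicit.
Unset Printing Implicit Defensive.

Local Open Scope classical_set_scope.
Local Open Scope ring_scope.

Section SigmaTopology.
Context {R : realType} {X : choiceType} {I : Type}.

(* sigma(X, I): the coarsest topology on X making every [pairing ^~ i]
   continuous, i.e. the initial topology of the map into the product R^I. *)
Definition sigma_topology (pairing : X -> I -> R) : Type :=
  initial_topology (pairing : X -> {ptws I -> R}).

HB.instance Definition _ (pairing : X -> I -> R) :=
  Topological.copy (sigma_topology pairing)
    (initial_topology (pairing : X -> {ptws I -> R})).

Lemma sigma_pairing_continuous (pairing : X -> I -> R) (i : I) :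
  continuous ((fun x => pairing x i) : sigma_topology pairing -> R).
Proof.
move=> x; apply: (@cvg_comp _ _ _ pairing (fun g : {ptws I -> R} => g i)).
  exact: (@initial_continuous X {ptws I -> R} pairing x).
exact: (@proj_continuous {classic I} (fun=> R) i).
Qed.

Lemma sigma_continuous (pairing : X -> I -> R) (Z : topologicalType)
    (g : Z -> sigma_topology pairing) :
  (forall i, continuous ((fun z => pairing (g z) i) : Z -> R)) -> continuous g.
Proof.
move=> h; apply: continuous_comp_initial => z.
apply/cvg_sup => i.
exact: (@continuous_comp_initial {ptws I -> R} Z R (fun f => f i)
  (fun z => pairing (g z)) (h i) z).
Qed.

End SigmaTopology.

Section Span.
Context {R : nzRingType} {V : lmodType R}.

Definition linear_span (A : set V) : set V :=
  [set v | exists n (a : 'I_n -> R) (w : 'I_n -> V),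
    (forall i, A (w i)) /\ v = \sum_(i < n) a i *: w i].

End Span.

Section NormBuilding.
Context {R : realFieldType} {V : lmodType R} (N : V -> R).
Hypothesis NZ : forall l x, N (l *: x) <= `|l| * N x.

Lemma norm_scale_eq l x : N (l *: x) = `|l| * N x.
Proof.
have [->|l0] := eqVneq l 0.
  apply/eqP; rewrite eq_le NZ/= normr0 mul0r.
  have NN : N x <= N (- x).
    by have := NZ (-1) (- x); rewrite scaleN1r opprK normrN normr1 mul1r.
  have N0 : N 0 = 0.
    have h1 : N 0 <= 0 by have := NZ 0 x; rewrite scale0r normr0 mul0r.
    have h2 := NZ 2 0; rewrite scaler0 ger0_norm// mulr_natl mulr2n in h2.
    by apply/eqP; rewrite eq_le h1/= -(lerD2l (N 0)) addr0.
  by rewrite scale0r N0.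
apply/eqP; rewrite eq_le NZ/= -ler_pdivlMl ?normr_gt0//.
by have := NZ l^-1 (l *: x); rewrite scalerA mulVf// scale1r normfV.
Qed.

End NormBuilding.

Section Dual.
Context {R : realType} (V : normedModType R).

Definition continuous_functional : {pred (V -> R^o)} :=
  mem [set f : V -> R^o | linear f /\ continuous f].

Record dual := Dual {
  dual_fun :> V -> R^o;
  dualP : dual_fun \in continuous_functional }.

HB.instance Definition _ := [isSub for dual_fun].
HB.instance Definition _ := [Choice of dual by <:].

Lemma dual_linear_subproof (phi : dual) : linear (dual_fun phi).
Proof. by have := dualP phi; rewrite inE => -[]. Qed.

HB.instance Definition _ (phi : dual) :=
  GRing.isLinear.Build R V R^o *:%R (dual_fun phi)
    (dual_linear_subproof phi).

Lemma dual_continuous (phi : dual) : continuous (dual_fun phi).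
Proof. by have := dualP phi; rewrite inE => -[]. Qed.

Lemma continuous_functional_submod_closed : submod_closed continuous_functional.
Proof.
split; first rewrite inE; first split.
- by move=> a x y /=; rewrite scaler0 addr0.
- by move=> x; exact: cst_continuous.
move=> a f g; rewrite !inE => -[lf cf] [lg cg]; split.
  move=> b x y; rewrite /= !fctE lf lg !scalerDr !scalerA (mulrC a).
  by rewrite addrACA.
move=> x; apply: (@continuousD _ _ _ (a *: f) g); last exact: cg.
by apply: continuousZr; exact: cf.
Qed.

HB.instance Definition _ := GRing.isSubmodClosed.Build R (V -> R^o)
  continuous_functional continuous_functional_submod_closed.
HB.instance Definition _ := [SubChoice_isSubLmodule of dual by <:].

Definition dual_norm (phi : dual) : R :=
  sup [set `|phi x| | x in [set x : V | `|x| <= 1]].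

Lemma dual_bounded (phi : dual) : exists C, forall x, `|phi x| <= C * `|x|.
Proof.
have /linear_boundedP := continuous_linear_bounded (0 : V)
  (@dual_continuous phi 0).
move=> [y [yr h]]; exists (y + 1) => x.
by apply: h; rewrite ltrDl.
Qed.

Lemma dual_norm_has_sup (phi : dual) :
  has_sup [set `|phi x| | x in [set x : V | `|x| <= 1]].
Proof.
split; first by exists `|phi 0|, 0 => //=; rewrite normr0.
have [C hC] := dual_bounded phi; exists `|C| => _ [x /= x1 <-].
apply: (le_trans (hC x)); apply: (le_trans (ler_norm _)).
by rewrite normrM normr_id ler_piMr.
Qed.

Lemma dual_norm_le (phi : dual) (x : V) : `|phi x| <= dual_norm phi * `|x|.
Proof.
have [->|x0] := eqVneq x 0; first by rewrite linear0 !normr0 mulr0.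
rewrite -ler_pdivrMr ?normr_gt0//.
apply: (ub_le_sup (dual_norm_has_sup phi).2).
exists (`|x|^-1 *: x) => /=.
  by rewrite normrZ normfV normr_id mulVf ?normr_eq0.
by rewrite linearZ/= normrZ normfV normr_id mulrC.
Qed.

Lemma dual_norm_ge (phi : dual) (C : R) : 0 <= C ->
  (forall x, `|phi x| <= C * `|x|) -> dual_norm phi <= C.
Proof.
move=> C0 h; apply: ge_sup; first exact: (dual_norm_has_sup phi).1.
by move=> _ [x /= x1 <-]; apply: (le_trans (h x)); rewrite ler_piMr.
Qed.

Lemma dual_norm_ge0 (phi : dual) : 0 <= dual_norm phi.
Proof.
apply: (ub_le_sup (dual_norm_has_sup phi).2).
by exists 0; rewrite /= ?linear0 normr0.
Qed.

Lemma dual_ler_normD (phi psi : dual) :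
  dual_norm (phi + psi) <= dual_norm phi + dual_norm psi.
Proof.
apply: dual_norm_ge; first by rewrite addr_ge0 ?dual_norm_ge0.
move=> x; apply: (le_trans (ler_normD _ _)).
by rewrite mulrDl lerD ?dual_norm_le.
Qed.

Lemma dual_normrZ (l : R) (phi : dual) :
  dual_norm (l *: phi) = `|l| * dual_norm phi.
Proof.
apply: norm_scale_eq => {l phi} l phi.
apply: dual_norm_ge; first by rewrite mulr_ge0 ?dual_norm_ge0.
move=> x; rewrite (_ : dual_fun _ x = l * phi x)// normrM -mulrA.
by rewrite ler_wpM2l ?dual_norm_le.
Qed.

Lemma dual_normr0_eq0 (phi : dual) : dual_norm phi = 0 -> phi = 0.
Proof.
move=> h; apply: val_inj; apply/funext => x /=.
apply/eqP; rewrite -normr_le0.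
by have := dual_norm_le phi x; rewrite h mul0r.
Qed.

HB.instance Definition _ := Lmodule_isNormed.Build R dual
  dual_ler_normD dual_normrZ dual_normr0_eq0.

End Dual.

Section Lip0.
Context {R : realType} {M : metricType R} (x0 : M).

Definition lipschitz_vanishing : {pred (M -> R^o)} :=
  mem [set f : M -> R^o | f x0 = 0 /\
    exists k : R, forall x y, `|f x - f y| <= k * mdist x y].

Record Lip0 := MkLip0 {
  Lip0_fun :> M -> R^o;
  Lip0P : Lip0_fun \in lipschitz_vanishing }.

HB.instance Definition _ := [isSub for Lip0_fun].
HB.instance Definition _ := [Choice of Lip0 by <:].

Lemma Lip0_base (f : Lip0) : f x0 = 0.
Proof. by have := Lip0P f; rewrite inE => -[]. Qed.

Lemma Lip0_lipschitz (f : Lip0) :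
  exists k : R, forall x y, `|f x - f y| <= k * mdist x y.
Proof. by have := Lip0P f; rewrite inE => -[]. Qed.

Lemma lipschitz_vanishing_submod_closed : submod_closed lipschitz_vanishing.
Proof.
split; first rewrite inE; first split => //.
  by exists 0 => x y; rewrite subrr normr0 mul0r.
move=> a f g; rewrite !inE => -[f0 [k hk]] [g0 [l hl]]; split.
  by rewrite !fctE f0 g0 scaler0 addr0.
exists (`|a| * k + l) => x y; rewrite !fctE opprD addrACA -scalerBr.
apply: (le_trans (ler_normD _ _)); rewrite mulrDl lerD//.
by rewrite normrZ -mulrA ler_wpM2l.
Qed.

HB.instance Definition _ := GRing.isSubmodClosed.Build R (M -> R^o)
  lipschitz_vanishing lipschitz_vanishing_submod_closed.
HB.instance Definition _ := [SubChoice_isSubLmodule of Lip0 by <:].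

(* If M is a singleton this is [sup set0], which is 0. *)
Definition Lip0_norm (f : Lip0) : R :=
  sup [set (f p.1 - f p.2) / mdist p.1 p.2 | p in [set p : M * M | p.1 != p.2]].

Lemma Lip0_norm_ubound (f : Lip0) : has_ubound
  [set (f p.1 - f p.2) / mdist p.1 p.2 | p in [set p : M * M | p.1 != p.2]].
Proof.
have [k hk] := Lip0_lipschitz f; exists k => _ [[x y] /= xy <-].
by rewrite ler_pdivrMr ?mdist_gt0// (le_trans (ler_norm _)).
Qed.

Lemma Lip0_norm_sub_le (f : Lip0) x y :
  f x - f y <= Lip0_norm f * mdist x y.
Proof.
have [->|xy] := eqVneq x y; first by rewrite subrr mdistxx mulr0.
rewrite -ler_pdivrMr ?mdist_gt0//.
by apply: (ub_le_sup (Lip0_norm_ubound f)); exists (x, y).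
Qed.

Lemma Lip0_norm_le (f : Lip0) x y :
  `|f x - f y| <= Lip0_norm f * mdist x y.
Proof.
rewrite ler_norml Lip0_norm_sub_le andbT lerNl opprB.
by rewrite metric_sym Lip0_norm_sub_le.
Qed.

Lemma Lip0_norm_ge (f : Lip0) (C : R) : 0 <= C ->
  (forall x y, `|f x - f y| <= C * mdist x y) -> Lip0_norm f <= C.
Proof.
move=> C0 h; rewrite /Lip0_norm; set A := [set _ | _ in _].
have [->|/set0P A0] := eqVneq A set0; first by rewrite sup0.
apply: ge_sup => // _ [[x y] /= xy <-].
by rewrite ler_pdivrMr ?mdist_gt0// (le_trans (ler_norm _)).
Qed.

Lemma Lip0_norm_ge0 (f : Lip0) : 0 <= Lip0_norm f.
Proof.
rewrite /Lip0_norm; set A := [set _ | _ in _].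
have [->|/set0P [_ [[x y] /= xy _]]] := eqVneq A set0; first by rewrite sup0.
have := le_trans (normr_ge0 _) (Lip0_norm_le f x y).
by rewrite pmulr_lge0// mdist_gt0.
Qed.

Lemma Lip0_ler_normD (f g : Lip0) :
  Lip0_norm (f + g) <= Lip0_norm f + Lip0_norm g.
Proof.
apply: Lip0_norm_ge; first by rewrite addr_ge0 ?Lip0_norm_ge0.
move=> x y.
rewrite (_ : _ - _ = (f x - f y) + (g x - g y)); last first.
  by rewrite addrACA -opprD.
by rewrite mulrDl (le_trans (ler_normD _ _))// lerD ?Lip0_norm_le.
Qed.

Lemma Lip0_normrZ (l : R) (f : Lip0) :
  Lip0_norm (l *: f) = `|l| * Lip0_norm f.
Proof.
apply: norm_scale_eq => {l f} l f.
apply: Lip0_norm_ge; first by rewrite mulr_ge0 ?Lip0_norm_ge0.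
move=> x y; rewrite (_ : _ - _ = l * (f x - f y)); last by rewrite mulrBr.
by rewrite normrM -mulrA ler_wpM2l ?Lip0_norm_le.
Qed.

Lemma Lip0_normr0_eq0 (f : Lip0) : Lip0_norm f = 0 -> f = 0.
Proof.
move=> h; apply: val_inj; apply/funext => x /=.
apply/eqP; rewrite -normr_le0.
by have := Lip0_norm_le f x x0; rewrite h mul0r Lip0_base subr0.
Qed.

HB.instance Definition _ := Lmodule_isNormed.Build R Lip0
  Lip0_ler_normD Lip0_normrZ Lip0_normr0_eq0.

Definition evaluation (x : M) (f : Lip0) : R^o := f x.

Lemma evaluation_linear x : linear (evaluation x).
Proof. by []. Qed.

HB.instance Definition _ x := GRing.isLinear.Build R Lip0 R^o *:%R
  (evaluation x) (evaluation_linear x).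

Lemma evaluation_functional x : evaluation x \in @continuous_functional R Lip0.
Proof.
rewrite inE; split; first exact: evaluation_linear.
apply: bounded_linear_continuous; apply/linear_boundedP.
exists (mdist x x0); split; first exact: num_real.
move=> r xr f; have := Lip0_norm_le f x x0.
rewrite Lip0_base subr0 => /le_trans; apply.
by rewrite mulrC ler_wpM2r// ?Lip0_norm_ge0// ltW.
Qed.

Definition delta (x : M) : dual Lip0 := Dual (evaluation_functional x).

Definition free_space : set (dual Lip0) := closure (linear_span (range delta)).

Definition Lip0_pairing (f : Lip0) (mu : free_space) : R := set_val mu f.

End Lip0.

Arguments free_space {R M} x0 _.
Arguments Lip0_pairing {R M} x0 f mu.

Definition dual_pairing {R : realType} (F : normedModType R)
  (phi : dual F) (x : F) : R := phi x.
Arguments dual_pairing {R} F phi x.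

(* Main.v *)
Require Import Defs.
From HB Require Import structures.
From mathcomp Require Import all_boot all_order all_algebra.
From mathcomp Require Import all_classical all_reals all_analysis.
From mathcomp Require Import ring lra.
Import Order.TTheory GRing.Theory Num.Theory.
Import numFieldNormedType.Exports.
Local Open Scope classical_set_scope.
Local Open Scope ring_scope.

Set Implicit Arguments.
Unset Strict Implicit.
Unset Printing Implicit Defensive.

(** Continuity of [T] means that, for every [y] in [F], the functional which
    sends [f] to [T f y], the action of [y], is a norm limit of linear
    combinations of evaluations.

    Because [T] is an isometry onto a dual space, bounded families of Lipschitz
    functions have limits along ultrafilters, in the sense that all actions
    converge ([wlim_exists]). Nothing relates this convergence to pointwise
    convergence a priori. All that is known is that balls of the Lipschitz
    norm, around any centre, are closed under it ([wlim_ball]): if the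
    increments of [u i + G] are at most [l] times the distance, then so are
    those of [h + G], where [h] is the limit. The whole argument consists in
    finding functions [G] for which this single fact forces [h] to be constant.

    By a finite-dimensional Hahn-Banach argument ([finite_hahn_banach]) it is
    enough that the action of [y] is small on the 1-Lipschitz functions which
    vanish on a suitable finite set ([finite_control]). Suppose that it is not.
    Families of functions that vanish within a fixed distance of more and more
    points have constant limits, and constants have no action, so such families
    can be discarded ([no_escaping_family]). Discarding them first at infinity
    ([bounded_escape]), then away from finite nets at the scales 1, 1/2, 1/4
    and so on ([cutoff_sequence]), leaves functions [g n] which tend uniformly
    to 0, have bounded Lipschitz constants and actions bounded below, and are
    supported in decreasing regions that shrink to a compact set when [M] is
    complete. A constant limit of the [g n] is then a contradiction.

    To compare the limit [h] at two points [p] and [q], call [z] a cut point of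
    the pair if one cannot travel from [p] to [q] by steps each of which is
    shorter, by a fixed margin, than the way through [z]. If [p] and [q] are
    the only cut points, then the supports of the [g n] are covered by finitely
    many small balls each of which can be bypassed, and they can be peeled off
    one by one ([wlim_no_cut_point]). In general the cut points form an
    isometric copy of a closed subset of a segment ([cut_isometry],
    [cut_closed]), and the [g n] restrict to functions of one real variable on
    it. Being free to replace them by averages, one makes their variation on
    this set as small as desired ([small_variation_exists]). A cheapest-route
    function ([potential]) built from these small variations is then a test
    function that pins [h p] and [h q] together ([wlim_cut_pair]). So [h] takes
    a single value on all the nets; away from the nets it is locally constant,
    and local constancy propagates to all scales ([scale_induction],
    [wlim_constant]).

    Completeness of [M] costs nothing: the completion carries the same
    Lipschitz space, and an evaluation at one of its points is a norm limit of
    evaluations at points of [M] ([evaluation_approximation]). *)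

(** * Lipschitz functions *)

Definition lip {R : realType} {M : metricType R} (k : R) (f : M -> R) :=
  forall x y, `|f x - f y| <= k * mdist x y.

Section LipFunctions.
Context {R : realType} {M : metricType R}.
Implicit Types (f g : M -> R) (k l : R).

Lemma lip_le k l f : k <= l -> lip k f -> lip l f.
Proof. by move=> kl h x y; rewrite (le_trans (h x y))// ler_wpM2r ?mdist_ge0. Qed.

Lemma lipD k l f g : lip k f -> lip l g -> lip (k + l) (fun x => f x + g x).
Proof.
move=> hf hg x y; rewrite opprD addrACA (le_trans (ler_normD _ _))//.
by rewrite mulrDl lerD.
Qed.

Lemma lipZ k a f : lip k f -> lip (`|a| * k) (fun x => a * f x).
Proof. by move=> hf x y; rewrite -mulrBr normrM -mulrA ler_wpM2l. Qed.

Lemma lipN k f : lip k f -> lip k (fun x => - f x).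
Proof. by move=> hf x y; rewrite -opprD normrN. Qed.

Lemma lipB k l f g : lip k f -> lip l g -> lip (k + l) (fun x => f x - g x).
Proof. by move=> hf /lipN; exact: lipD. Qed.

Lemma lip_cst k a : 0 <= k -> lip k (fun _ : M => a : R).
Proof. by move=> k0 x y; rewrite subrr normr0 mulr_ge0 ?mdist_ge0. Qed.

Lemma lip_one_sided k f : (forall x y, f x - f y <= k * mdist x y) -> lip k f.
Proof. by move=> h x y; rewrite ler_norml h andbT lerNl opprB metric_sym h. Qed.

Lemma lip_mdist (z : M) : lip 1 (fun x => mdist x z).
Proof.
apply: lip_one_sided => x y; rewrite mul1r lerBlDr.
exact: metric_triangle.
Qed.

Lemma lip_max k f g : lip k f -> lip k g -> lip k (fun x => Num.max (f x) (g x)).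
Proof.
move=> hf hg; apply: lip_one_sided => x y; rewrite lerBlDr ge_max.
have := hf x y; have := hg x y; rewrite !ler_norml => /andP[_ h1] /andP[_ h2].
have h3 : f y <= Num.max (f y) (g y) by rewrite le_max lexx.
have h4 : g y <= Num.max (f y) (g y) by rewrite le_max lexx orbT.
by apply/andP; split; lra.
Qed.

Lemma lip_min k f g : lip k f -> lip k g -> lip k (fun x => Num.min (f x) (g x)).
Proof.
move=> hf hg; apply: lip_one_sided => x y; rewrite lerBlDr -lerBlDl le_min.
have := hf x y; have := hg x y; rewrite !ler_norml => /andP[_ h1] /andP[_ h2].
have h3 : Num.min (f x) (g x) <= f x by rewrite ge_min lexx.
have h4 : Num.min (f x) (g x) <= g x by rewrite ge_min lexx orbT.
by apply/andP; split; lra.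
Qed.

End LipFunctions.

(** * Limits of bounded families of Lipschitz functions *)

Section WeakLimits.
Context {R : realType} {M : metricType R} (x0 : M) {F : normedModType R}.
Variable T : {linear Lip0 x0 -> dual F}.

Lemma anchor_subproof (f : M -> R) : (exists k, lip k f) ->
  (fun x => f x - f x0 : R^o) \in lipschitz_vanishing x0.
Proof.
move=> [k hk]; rewrite inE; split; first by rewrite subrr.
by exists k => x y; rewrite opprB addrA subrK; exact: hk.
Qed.

(** Test functions are only meaningful up to constants and are built without a
    base point in mind; they are normalized here, once and for all. A function
    that is not Lipschitz is sent to the junk value 0. *)
Definition anchor (f : M -> R) : Lip0 x0 :=
  if pselect (exists k, lip k f) is left h then MkLip0 (anchor_subproof h) else 0.

Lemma anchorE k f : lip k f -> forall x, anchor f x = f x - f x0.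
Proof. by move=> h x; rewrite /anchor; case: pselect => // -[]; exists k. Qed.

Definition action (y : F) (f : M -> R) : R := T (anchor f) y.

Lemma lip_of_norm (f : Lip0 x0) (k : R) : `|f| <= k -> lip k f.
Proof.
move=> fk x y; apply: (le_trans (Lip0_norm_le f x y)).
by rewrite ler_wpM2r ?mdist_ge0.
Qed.

Lemma norm_of_lip (f : Lip0 x0) (k : R) : 0 <= k -> lip k f -> `|f| <= k.
Proof. by move=> k0 h; exact: Lip0_norm_ge. Qed.

Lemma lip_anchor k f : lip k f -> lip k (anchor f).
Proof. by move=> h x y; rewrite !(anchorE h) opprB addrA subrK. Qed.

Lemma anchor_id (f : Lip0 x0) : anchor f = f.
Proof.
have [k hk] := Lip0_lipschitz f.
by apply: val_inj; apply/funext => x /=; rewrite (anchorE hk) Lip0_base subr0.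
Qed.

Lemma anchor_linear k l a f g : lip k f -> lip l g ->
  anchor (fun x => a * f x + g x) = a *: anchor f + anchor g.
Proof.
move=> hf hg; apply: val_inj; apply/funext => x /=.
rewrite (anchorE (lipD (lipZ a hf) hg)).
rewrite -[RHS]/(a * anchor f x + anchor g x).
by rewrite (anchorE hf) (anchorE hg); ring.
Qed.

Lemma action_linear y k l a f g : lip k f -> lip l g ->
  action y (fun x => a * f x + g x) = a * action y f + action y g.
Proof. by move=> hf hg; rewrite /action (anchor_linear _ hf hg) linearP. Qed.

Hypothesis T_isometry : forall f, `|T f| = `|f|.
Hypothesis T_surjective : forall phi : dual F, exists f, T f = phi.

Lemma action_bound y k f : 0 <= k -> lip k f -> `|action y f| <= k * `|y|.
Proof.
move=> k0 h; apply: (le_trans (dual_norm_le _ _)).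
apply: ler_wpM2r => //; rewrite -[dual_norm _]/(`|T (anchor f)|) T_isometry.
exact/norm_of_lip/lip_anchor.
Qed.

(** The weak* convergence of the dual of [F], pulled back along [T]. *)
Definition wlim {I : Type} (U : set_system I) (u : I -> M -> R) (h : M -> R) :=
  forall y : F, (action y (u i) @[i --> U]) --> action y h.

Lemma ultra_bounded_cvg (I : Type) (U : set_system I) (a : I -> R) (c : R) :
  UltraFilter U -> (\forall i \near U, `|a i| <= c) ->
  exists2 l, a i @[i --> U] --> l & `|l| <= c.
Proof.
move=> UU ac.
have [|l [lc al]] := @segment_compact R (- c) c (a @ U) _.
  by apply: filterS ac => i; rewrite /= in_itv/= ler_norml.
exists l; last by move: lc; rewrite /= in_itv/= -ler_norml.
move=> B /= Bl.
have [//|UnB] := in_ultra_setVsetC (a @^-1` B) UU.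
have aU : (a @ U) (~` B) by exact: UnB.
by have [x []] := al _ _ aU Bl.
Qed.

(** The Banach-Alaoglu theorem: the limits of the actions of the various [y]
    form a bounded functional on [F], which is attained because [T] is onto. *)
Lemma wlim_exists (I : Type) (U : set_system I) (u : I -> M -> R) (C : R) :
  UltraFilter U -> 0 <= C -> (\forall i \near U, lip C (u i)) ->
  exists h, [/\ lip C h, h x0 = 0 & wlim U u h].
Proof.
move=> UU C0 uC.
have /choice[L hL] (y : F) : exists l, (action y (u i) @[i --> U]) --> l /\
    `|l| <= C * `|y|.
  have [l l1 l2] := @ultra_bounded_cvg I U (fun i => action y (u i)) (C * `|y|) UU
    (filterS (fun i h => action_bound y C0 h) uC).
  by exists l.
have Llin : linear (L : F -> R^o).
  move=> a y z.
  have h1 := (hL (a *: y + z)).1.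
  have h2 : (action (a *: y + z) (u i) @[i --> U]) --> a * L y + L z.
    rewrite (_ : (fun i => _) = (fun i => a * action y (u i) + action z (u i))).
      by apply: cvgD; [apply: cvgM; [exact: cvg_cst|exact: (hL y).1]|exact: (hL z).1].
    by apply/funext => i; rewrite /action linearP.
  exact: (cvg_unique _ h1 h2).
pose Llin' : {linear F -> R^o} :=
  HB.pack (L : F -> R^o) (GRing.isLinear.Build R F R^o *:%R L Llin).
have Lc : (L : F -> R^o) \in @continuous_functional R F.
  rewrite inE; split => //; apply: (@bounded_linear_continuous _ _ _ Llin').
  apply/linear_boundedP; exists C; split; first exact: num_real.
  by move=> r Cr y; rewrite (le_trans (hL y).2)// ler_wpM2r// ltW.
have [f fL] := T_surjective (Dual Lc).
exists f; split.
- apply: lip_of_norm; rewrite -T_isometry fL.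
  by apply: dual_norm_ge => // y; exact: (hL y).2.
- exact: Lip0_base.
- by move=> y; rewrite /action anchor_id fL; exact: (hL y).1.
Qed.

Lemma norm_le_action (f : Lip0 x0) (C : R) : 0 <= C ->
  (forall y, `|action y f| <= C * `|y|) -> `|f| <= C.
Proof.
move=> C0 h; rewrite -T_isometry; apply: dual_norm_ge => // y.
by have := h y; rewrite /action anchor_id.
Qed.

(** The ball of radius [l] centred at [- G] is defined by inequalities on single
    actions, [T] being an isometry, and these pass to the limit. This is the only
    link between the limit [h] and the metric of [M]. *)
Lemma wlim_ball (I : Type) (U : set_system I) (u : I -> M -> R) (h G : M -> R)
    (C C' l : R) : ProperFilter U -> wlim U u h -> 0 <= l ->
  lip C' h -> (\forall i \near U, lip C (u i)) ->
  (\forall i \near U, forall x y,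
    u i x - u i y + (G x - G y) <= l * mdist x y) ->
  forall x y, h x - h y + (G x - G y) <= l * mdist x y.
Proof.
move=> PU uh l0 hC uC uG.
have [i [uiC uiG]] := filter_ex (filterI uC uG).
have GC : lip (l + C) G.
  apply: lip_one_sided => x y; rewrite mulrDl.
  have := uiG x y; have := uiC x y; rewrite ler_norml => /andP[]; lra.
suff H : lip l (fun x => 1 * h x + G x).
  move=> x y; have := H x y; rewrite !mul1r => /(le_trans (ler_norm _)).
  by rewrite opprD addrACA.
have H1 := lipD (lipZ 1 hC) GC.
suff : `|anchor (fun x => 1 * h x + G x)| <= l.
  move=> /lip_of_norm H x y.
  by have := H x y; rewrite !(anchorE H1) opprB addrA subrK.
apply: norm_le_action => // y; rewrite {1}/action anchor_id.
rewrite -[T _ y]/(action y (fun x => 1 * h x + G x)) (action_linear y 1 hC GC).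
have : (1 * action y (u i) + action y G @[i --> U]) --> 1 * action y h + action y G.
  by apply: cvgD; [apply: cvgM; [exact: cvg_cst|exact: uh]|exact: cvg_cst].
move=> /cvg_norm/cvgr_to_le; apply => //.
near=> j.
have ujC : lip C (u j) by near: j.
rewrite -(action_linear y 1 ujC GC); apply: action_bound => //.
apply: lip_one_sided => a b; rewrite !mul1r opprD addrACA.
by move: a b; near: j.
Unshelve. all: by end_near. Qed.

Lemma wlimB (I : Type) (U : set_system I) (u v : I -> M -> R) (h k : M -> R)
    (C : R) : ProperFilter U -> wlim U u h -> wlim U v k ->
  lip C h -> lip C k ->
  (\forall i \near U, lip C (u i)) -> (\forall i \near U, lip C (v i)) ->
  wlim U (fun i x => u i x - v i x) (fun x => h x - k x).
Proof.
move=> PU uh vk hC kC uC vC y.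
have e f g : lip C f -> lip C g ->
    action y (fun x => f x - g x) = action y f - action y g.
  move=> fC gC; have := action_linear y (-1) gC fC.
  rewrite (_ : (fun x => _) = (fun x => f x - g x)).
    by move=> ->; rewrite mulN1r addrC.
  by apply/funext => x; rewrite mulN1r addrC.
rewrite (e _ _ hC kC).
have H : (action y (u i) - action y (v i) @[i --> U]) --> action y h - action y k.
  by apply: cvgB; [exact: uh|exact: vk].
apply: cvg_trans H; apply: near_eq_cvg; near=> i; apply/esym/e; by near: i.
Unshelve. all: by end_near. Qed.

End WeakLimits.

(** * Tests by chains, cones and balls *)

Section Chains.
Context {R : realType} {A : Type}.
Implicit Types (c : A -> A -> R) (l : seq A).

Fixpoint chain_cost c x l : R :=
  if l is y :: l' then c x y + chain_cost c y l' else 0.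

Lemma chain_cost_cat c x l1 l2 :
  chain_cost c x (l1 ++ l2) = chain_cost c x l1 + chain_cost c (last x l1) l2.
Proof.
elim: l1 x => [|y l1 IH] x /=; first by rewrite add0r.
by rewrite IH addrA.
Qed.

Lemma chain_cost_le c c' x l : (forall a b, c a b <= c' a b) ->
  chain_cost c x l <= chain_cost c' x l.
Proof. by move=> h; elim: l x => //= y l IH x; rewrite lerD. Qed.

Lemma chain_cost_linear c c' a x l :
  chain_cost (fun x y => a * c x y - c' x y) x l =
  a * chain_cost c x l - chain_cost c' x l.
Proof.
elim: l x => [|y l IH] x /=; first by rewrite mulr0 subrr.
by rewrite IH; ring.
Qed.

Lemma chain_costZ c a x l :
  chain_cost (fun x y => a * c x y) x l = a * chain_cost c x l.
Proof.
by elim: l x => [|y l IH] x /=; rewrite ?mulr0// IH mulrDr.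
Qed.

Lemma chain_cost_ge0 c x l : (forall a b, 0 <= c a b) -> 0 <= chain_cost c x l.
Proof. by move=> h; elim: l x => //= y l IH x; rewrite addr_ge0. Qed.

End Chains.

Lemma chain_length_ge {R : realType} {M : metricType R} (x : M) (l : seq M) :
  mdist x (last x l) <= chain_cost mdist x l.
Proof.
elim: l x => [|y l IH] x /=; first by rewrite mdistxx.
by rewrite (le_trans (metric_triangle _ y _))// lerD.
Qed.

Section LocalTests.
Context {R : realType} {M : metricType R} (x0 : M) {F : normedModType R}.
Variable T : {linear Lip0 x0 -> dual F}.
Hypothesis T_isometry : forall f, `|T f| = `|f|.
Context {I : Type} (U : set_system I) {PU : ProperFilter U}.
Variables (u : I -> M -> R) (h : M -> R) (C : R).
Hypothesis C0 : 0 <= C.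
Hypothesis uh : wlim T U u h.
Hypothesis hC : lip C h.
Hypothesis uC : \forall i \near U, lip C (u i).

Lemma wlim_ball_abs (G : M -> R) (l : R) : 0 <= l ->
  (\forall i \near U, forall x y,
    `|u i x - u i y| + `|G x - G y| <= l * mdist x y) ->
  forall x y, `|h x - h y| + `|G x - G y| <= l * mdist x y.
Proof.
move=> l0 H.
have H1 x y : h x - h y + (G x - G y) <= l * mdist x y.
  refine (wlim_ball T_isometry PU uh l0 hC uC (G := G) _ x y); apply: filterS H => i H a b.
  by apply: le_trans (H a b); apply: lerD; exact: ler_norm.
have H2 x y : h x - h y + (- G x - - G y) <= l * mdist x y.
  refine (wlim_ball T_isometry PU uh l0 hC uC (G := fun x => - G x) _ x y).
  apply: filterS H => i H a b; rewrite -opprD.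
  apply: le_trans (H a b); apply: lerD; rewrite ?ler_norm//.
  by rewrite -normrN; exact: ler_norm.
move=> x y; have := H1 x y; have := H1 y x; have := H2 x y; have := H2 y x.
rewrite (metric_sym y x); case: (ger0P (h x - h y)) => _;
  case: (ger0P (G x - G y)) => _; lra.
Qed.

(** Among the functions whose increments are at most [c], the cheapest cost of a
    chain to [q] is the one that separates [p] from [q] most, hence the best
    test that a given room [c] allows. *)
Lemma wlim_chain (c : M -> M -> R) (l B : R) (p q : M) : 0 <= l ->
  (forall x y, 0 <= c x y) ->
  (\forall i \near U, forall x y, u i x - u i y + c x y <= l * mdist x y) ->
  (forall s, last p s = q -> B <= chain_cost c p s) ->
  h p - h q <= l * mdist p q - B.
Proof.
move=> l0 c0 H hB.
pose E x := [set chain_cost c x s | s in [set s | last x s = q]].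
have E0 x : E x !=set0 by exists (chain_cost c x [:: q]), [:: q].
have Elb x : has_lbound (E x) by exists 0 => _ [s _ <-]; exact: chain_cost_ge0.
pose G x := inf (E x).
have Gc x y : G x - G y <= c x y.
  rewrite lerBlDr -lerBlDl; apply: lb_le_inf => // _ [s /= sq <-].
  by rewrite lerBlDl; apply: ge_inf => //; exists (y :: s).
have Gp : B <= G p by apply: lb_le_inf => // _ [s /= /hB ? <-].
have Gq : G q <= 0 by apply: ge_inf => //; exists [::].
have := wlim_ball T_isometry PU uh l0 hC uC (G := G) _ p q.
suff : \forall i \near U, forall x y, u i x - u i y + (G x - G y) <= l * mdist x y.
  by move=> H1 /(_ H1); lra.
apply: filterS H => i H x y; apply: le_trans (H x y).
by rewrite lerD2l.
Qed.

(** The test [G] is a cone with top at [p], supported where the [u i] vanish, and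
    twice as steep as them: it meets the constraint of slope [2 * C] on its own,
    and uses it up completely between [p] and [q], so that [h] cannot vary. *)
Lemma wlim_local (p q : M) (r : R) : mdist p q <= r ->
  (\forall i \near U, forall x, mdist p x <= 2 * r -> u i x = 0) -> h p = h q.
Proof.
move=> pqr u0.
pose G x := (2 * C) * Num.max 0 (mdist p q - mdist x p).
have C2 : 0 <= 2 * C by rewrite mulr_ge0.
have Glip : lip (2 * C * 1) G.
  rewrite -[X in lip (X * 1)](ger0_norm C2); apply: lipZ; apply: lip_max.
    by apply: lip_cst.
  by rewrite -[1]add0r; apply: lipB; [exact: lip_cst|exact: lip_mdist].
have := @wlim_ball_abs G (2 * C) C2 _ p q.
suff H : \forall i \near U, forall x y,
    `|u i x - u i y| + `|G x - G y| <= 2 * C * mdist x y.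
  move=> /(_ H); rewrite /G mdistxx subr0 (metric_sym q) subrr maxxx mulr0 subr0.
  rewrite (max_idPr (mdist_ge0 _ _)) (@ger0_norm _ (2 * C * _)) ?mulr_ge0 ?mdist_ge0//.
  rewrite -[leRHS]add0r lerD2r normr_le0.
  by rewrite subr_eq0 => /eqP.
near=> i.
have u0i : forall x, mdist p x <= 2 * r -> u i x = 0 by near: i.
have uiC : lip C (u i) by near: i.
have r0 : 0 <= r by rewrite (le_trans _ pqr)// mdist_ge0.
(* G vanishes at y, and the cone over x is at most half as high as y is far *)
have far x y : 2 * r < mdist p y -> `|u i x - u i y| + `|G x - G y| <= 2 * C * mdist x y.
  move=> yr; have Gy : G y = 0.
    by rewrite /G (max_idPl _) ?mulr0// (metric_sym y); lra.
  rewrite Gy subr0 (@ger0_norm _ (G x)); last by rewrite /G mulr_ge0// le_max lexx.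
  have h1 := uiC x y; have h2 := metric_triangle p x y.
  suff h3 : 2 * Num.max 0 (mdist p q - mdist x p) <= mdist x y.
    have := ler_wpM2l C0 h3; rewrite /G; lra.
  rewrite (metric_sym x p).
  by case: (leP 0 (mdist p q - mdist p x)) => _; have := mdist_ge0 x y; have := mdist_ge0 p x; lra.
move=> x y; case: (leP (mdist p y) (2 * r)) => [yr|]; last exact: far.
case: (leP (mdist p x) (2 * r)) => [xr|xr].
  by rewrite !u0i// subrr normr0 add0r; have := Glip x y; rewrite mulr1.
by rewrite distrC (distrC (G x)) metric_sym; exact: far.
Unshelve. all: by end_near. Qed.

(** The test [G] is [C] times the distance to [y] in the space where the ball of
    radius [rho + kap] about [z] is collapsed to a point. It is constant on the
    supports, and a function bounded by [C * kap] is paid for by the collar of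
    width [kap] around them. Unless the ball nearly lies on the way from [x] to
    [y], the collapse does not shorten this way and [G] uses all the slope. *)
Lemma wlim_small_support (z : M) (rho kap : R) :
  (\forall i \near U, forall a, u i a != 0 -> mdist a z <= rho) ->
  0 <= kap -> (\forall i \near U, forall a, `|u i a| <= C * kap) ->
  forall x y, `|h x - h y| <=
    C * (mdist x y - Num.min (mdist x y)
      (Num.max 0 (mdist x z - (rho + kap)) + Num.max 0 (mdist y z - (rho + kap)))).
Proof.
move=> usupp kap0 usmall x y.
(* the distance to the ball that is collapsed *)
pose beta a := Num.max 0 (mdist a z - (rho + kap)).
have beta0 a : 0 <= beta a by rewrite /beta le_max lexx.
have betalip : lip 1 beta.
  apply: lip_max; first exact: lip_cst.
  by rewrite -[1]addr0; apply: lipB; [exact: lip_mdist|exact: lip_cst].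
(* the distance to y in the collapsed space: directly, or through the ball *)
pose psi a := Num.min (mdist a y) (beta a + beta y).
have psilip : lip 1 psi.
  apply: lip_min; first exact: lip_mdist.
  by rewrite -[1]addr0; apply: lipD => //; exact: lip_cst.
have psinear a : mdist a z <= rho + kap -> psi a = beta y.
  move=> az; have ba : beta a = 0 by rewrite /beta (max_idPl _)// subr_le0.
  rewrite /psi ba add0r (min_idPr _)// /beta ge_max mdist_ge0/= lerBlDr.
  rewrite (le_trans (metric_triangle y a z))// (metric_sym y).
  by rewrite lerD2l.
have psib b : `|psi b - beta y| <= beta b.
  rewrite ler_norml; apply/andP; split; last first.
    by rewrite lerBlDr /psi ge_min lexx orbT.
  rewrite lerBrDr /psi le_min; apply/andP; split; last first.
    by rewrite lerD2r ge0_cp.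
  have := betalip y b; rewrite mul1r ler_norml => /andP[_].
  by rewrite (metric_sym b); lra.
have psiy : psi y = 0.
  by rewrite /psi mdistxx (min_idPl _)// addr_ge0.
pose G a := C * psi a.
suff H : \forall i \near U, forall a b,
    `|u i a - u i b| + `|G a - G b| <= C * mdist a b.
  have psix : 0 <= psi x by rewrite /psi le_min mdist_ge0 addr_ge0.
  have := @wlim_ball_abs G C C0 H x y.
  rewrite /G psiy mulr0 subr0 (@ger0_norm _ (C * _)) ?mulr_ge0//.
  by rewrite -/(beta x) -/(beta y) -/(psi x) mulrBr lerBrDr.
near=> i.
have uiC : lip C (u i) by near: i.
have uis : forall a, u i a != 0 -> mdist a z <= rho by near: i.
have uik : forall a, `|u i a| <= C * kap by near: i.
have Gabs a b : `|G a - G b| = C * `|psi a - psi b|.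
  by rewrite /G -mulrBr normrM ger0_norm.
have mixed a b : u i a != 0 -> u i b = 0 -> `|u i a - u i b| + `|G a - G b| <= C * mdist a b.
  move=> ua ub; rewrite Gabs.
  have az := uis _ ua.
  have [bz|bz] := leP (mdist b z) (rho + kap).
    by rewrite !psinear// ?subrr ?normr0 ?mulr0 ?addr0//; lra.
  rewrite ub subr0 (psinear a); last by lra.
  rewrite distrC.
  have h1 : beta b <= mdist a b - kap.
    rewrite /beta (max_idPr _); last by lra.
    have := metric_triangle b a z; rewrite (metric_sym b a); lra.
  have := ler_wpM2l C0 (le_trans (psib b) h1); have := uik a.
  by rewrite mulrBr; lra.
move=> a b.
have [ua|ua] := eqVneq (u i a) 0; have [ub|ub] := eqVneq (u i b) 0.
- rewrite ua ub subrr normr0 add0r Gabs; apply: ler_wpM2l => //.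
  by have := psilip a b; rewrite mul1r.
- by rewrite distrC (distrC (G a)) metric_sym; exact: mixed.
- exact: mixed.
- rewrite Gabs !psinear ?subrr ?normr0 ?mulr0 ?addr0//.
  + by have := uis _ ub; lra.
  + by have := uis _ ua; lra.
Unshelve. all: by end_near. Qed.

End LocalTests.

(** * From constancy at one scale to constancy *)

Section Rigidity.
Context {R : realType} {M : metricType R} (x0 : M) {F : normedModType R}.
Variable T : {linear Lip0 x0 -> dual F}.
Hypothesis T_isometry : forall f, `|T f| = `|f|.

Lemma long_step (psi : M -> R) (tau eps : R) (p : M) (s : seq M) :
  (forall x y, mdist x y <= tau -> psi x - psi y <= eps * mdist x y) ->
  (exists s1 b s2, s = s1 ++ b :: s2 /\ tau < mdist (last p s1) b) \/
  psi p - psi (last p s) <= eps * chain_cost mdist p s.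
Proof.
move=> H; elim: s p => [|y s IH] p /=; first by right; rewrite subrr mulr0.
have [py|py] := leP (mdist p y) tau; last by left; exists [::], y, s.
have [[s1 [b [s2 [-> ?]]]]|h] := IH y; first by left; exists (y :: s1), b, s2.
by right; have := H _ _ py; rewrite mulrDr; lra.
Qed.

Context {I : Type} (U : set_system I) {PU : ProperFilter U}.
Variables (u : I -> M -> R) (h : M -> R) (C : R).
Hypothesis C0 : 0 < C.
Hypothesis uh : wlim T U u h.
Hypothesis hC : lip C h.
Hypothesis uC : \forall i \near U, lip C (u i).

(** That [psi] has slope at most [eps], for any fixed [eps], is extended from
    distances at most [t] to distances at most [t * (1 + kap)]. If all steps of
    a chain from [p] to [q] are shorter than [t], then [psi] is already known
    to increase little along it. Otherwise the chain is much longer than the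
    distance of [p] and [q], or it consists of one long step and a short
    remainder. In the last case the long step joins points near [p] and [q],
    and there the last hypothesis says that the [u i] hardly differ. So
    functions with the increments of the [u i] leave enough room, along every
    chain, for a test that keeps [h p - h q] small, and with it [psi p - psi
    q]. *)
Lemma scale_induction (psi : M -> R) (tau0 : R) : 0 < tau0 ->
  (forall x y, psi x - psi y <= Num.max 0 (h x - h y)) ->
  (forall x y, mdist x y <= tau0 -> psi x = psi y) ->
  (forall p q (eta : R), 0 < eta -> \forall i \near U, forall a b,
    `|u i a - u i b| <= C * (Num.min (mdist a p) (mdist a q) +
                            Num.min (mdist b p) (mdist b q)) + eta) ->
  forall x y, psi x = psi y.
Proof.
move=> tau00 psih psi0 ulong.
suff H (eps : R) x y : 0 < eps -> psi x - psi y <= eps * mdist x y.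
  have H1 x y : psi x <= psi y.
    rewrite -subr_le0; apply/ler_addgt0Pr => /= e e0; rewrite add0r.
    have d1 : 0 < mdist x y + 1 by have := mdist_ge0 x y; lra.
    apply: (le_trans (H (e / (mdist x y + 1)) x y _)); first by rewrite divr_gt0.
    rewrite -mulrA ler_piMr ?(ltW e0)// mulrC ler_pdivrMr//; lra.
  by move=> x y; apply/eqP; rewrite eq_le !H1.
move=> eps0; pose kap := Num.min 1 (eps / (12 * C)).
have kap0 : 0 < kap by rewrite /kap lt_min ltr01 divr_gt0// mulr_gt0.
have kap1 : kap <= 1 by rewrite /kap ge_min lexx.
have kapC : kap * (12 * C) <= eps.
  by rewrite -ler_pdivlMr ?mulr_gt0// /kap ge_min lexx orbT.
suff {x y} key n x y : mdist x y <= tau0 * (1 + n%:R * kap) ->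
    psi x - psi y <= eps * mdist x y.
  apply: (key (Num.bound (mdist x y / (tau0 * kap)))).
  have := archi_boundP (divr_ge0 (mdist_ge0 x y) (mulr_ge0 (ltW tau00) (ltW kap0))).
  rewrite ltr_pdivrMr ?mulr_gt0//; lra.
elim: n x y => [|n IH] p q.
  rewrite mul0r addr0 mulr1 => /psi0 ->.
  by rewrite subrr mulr_ge0 ?mdist_ge0// ltW.
set t := tau0 * (1 + n%:R * kap) in IH *.
have tt : tau0 <= t by rewrite /t ler_peMr ?(ltW tau00)// lerDl mulr_ge0// ltW.
move=> dle; have {}dle : mdist p q <= t * (1 + kap).
  have e : tau0 * (1 + n.+1%:R * kap) = t + tau0 * kap by rewrite /t -natr1; ring.
  by rewrite (le_trans dle)// e mulrDr mulr1 lerD2l ler_wpM2r// ltW.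
have [/IH//|td] := leP (mdist p q) t; set d := mdist p q in dle td *.
have t0 : 0 < t by lra.
have d0 : 0 < d by lra.
rewrite leNgt; apply/negP => Hlt.
pose delta := Num.min kap ((psi p - psi q - eps * d) / (2 * eps * d)).
have delta0 : 0 < delta.
  by rewrite /delta lt_min kap0 divr_gt0 ?subr_gt0// !mulr_gt0.
have deltak : delta <= kap by rewrite /delta ge_min lexx.
have delta2 : eps * ((1 + delta) * d) < psi p - psi q.
  have : delta * (2 * eps * d) <= psi p - psi q - eps * d.
    by rewrite -ler_pdivlMr ?mulr_gt0// /delta ge_min lexx orbT.
  have : 0 < eps * (delta * d) by rewrite !mulr_gt0.
  rewrite !mulrDl !mulrDr mul1r; nra.
have hpsi : psi p - psi q <= h p - h q.
  have := psih p q; have : 0 < eps * d by rewrite mulr_gt0.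
  by case: (leP 0 (h p - h q)) => _; lra.
pose D a := Num.min (mdist a p) (mdist a q).
pose eta := eps * t / 2.
have eta0 : 0 < eta by rewrite /eta divr_gt0// mulr_gt0.
pose theta a b := Num.min (C * mdist a b) (C * (D a + D b) + eta).
pose lam := C / delta + C.
have Cd0 : 0 < C / delta by rewrite divr_gt0.
have thetaC a b : theta a b <= C * mdist a b by rewrite /theta ge_min lexx.
have lam0 : 0 <= lam by rewrite /lam addr_ge0 ?ltW.
suff : h p - h q <= lam * d - (lam * d - eps * d).
  move=> hh.
  suff : eps * d < eps * ((1 + delta) * d) by lra.
  by rewrite ltr_pM2l// mulrDl mul1r ltrDl mulr_gt0.
apply: (wlim_chain T_isometry uh hC uC
  (c := fun a b => lam * mdist a b - theta a b)) => //.
- move=> a b; have := thetaC a b; have := mdist_ge0 a b; rewrite subr_ge0 /lam.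
  move=> ab0 /le_trans; apply; apply: ler_wpM2r => //; lra.
(* theta is the better of two bounds for the increments of u i: the Lipschitz
   bound and the one in terms of the distances to p and q *)
- apply: filterS2 uC (ulong p q eta eta0) => i uiC uil a b.
  suff : u i a - u i b <= theta a b by lra.
  rewrite /theta le_min; apply/andP; split.
    exact: le_trans (ler_norm _) (uiC a b).
  exact: le_trans (ler_norm _) (uil a b).
- move=> s sq; rewrite chain_cost_linear.
  set len := chain_cost mdist p s.
  have lend : d <= len by rewrite /d -sq; exact: chain_length_ge.
  (* a chain this long costs enough because lam exceeds C by C / delta *)
  have [small|big] := leP len ((1 + delta) * d); last first.
    have h1 : chain_cost theta p s <= C * len.
      by rewrite /len -chain_costZ; apply: chain_cost_le.
    have h2 : C / delta * ((1 + delta) * d) <= C / delta * len.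
      by rewrite ler_pM2l// ltW.
    have h3 : C / delta * ((1 + delta) * d) = (C / delta + C) * d.
      by rewrite mulrA mulrDr mulr1 divfK// gt_eqF.
    have h4 : 0 < eps * d by rewrite mulr_gt0.
    rewrite /lam mulrDl; move: h2; rewrite h3 => h2; lra.
  have [|] := @long_step psi t eps p s IH; last first.
    rewrite sq -/len => h1.
    have := ler_wpM2l (ltW eps0) small; lra.
  (* what the long step leaves of the chain has length at most 3 * kap * t *)
  move=> [s1 [b [s2 [es lab]]]].
  set a := last p s1 in lab.
  have lene : len = chain_cost mdist p s1 + (mdist a b + chain_cost mdist b s2).
    by rewrite /len es chain_cost_cat.
  have l1 : D a <= chain_cost mdist p s1.
    by rewrite /D ge_min metric_sym chain_length_ge.
  have l2 : D b <= chain_cost mdist b s2.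
    rewrite /D ge_min; apply/orP; right.
    have <- : last b s2 = q by rewrite -sq es last_cat.
    exact: chain_length_ge.
  have cs x s' : chain_cost theta x s' <= C * chain_cost mdist x s'.
    by rewrite -chain_costZ; apply: chain_cost_le.
  have thab : theta a b <= C * (D a + D b) + eta by rewrite /theta ge_min lexx orbT.
  have the : chain_cost theta p s =
      chain_cost theta p s1 + (theta a b + chain_cost theta b s2).
    by rewrite es chain_cost_cat.
  set rest := chain_cost mdist p s1 + chain_cost mdist b s2.
  have r1 : rest <= 3 * kap * t.
    have : len <= (1 + kap) * (t * (1 + kap)).
      apply: (le_trans small); apply: ler_pM => //; try lra.
    have : kap * kap * t <= kap * t.
      by rewrite ler_wpM2r ?(ltW t0)// ler_piMl// ltW.
    rewrite /rest lene; lra.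
  have r2 : chain_cost theta p s <= 2 * (C * rest) + eta.
    rewrite the /rest.
    have := cs p s1; have := cs b s2; have := ler_wpM2l (ltW C0) l1.
    have := ler_wpM2l (ltW C0) l2; lra.
  have r3 : 2 * (C * rest) <= eps * t / 2.
    have := ler_wpM2l (ltW C0) r1; have := ler_wpM2r (ltW t0) kapC; lra.
  have r4 : eps * t <= eps * d by rewrite ler_wpM2l// ltW.
  have r5 : lam * d <= lam * len by rewrite ler_wpM2l.
  by rewrite /eta in r2; lra.
Qed.

End Rigidity.

Section Tightness.
Context {R : realType} {M : metricType R} (x0 : M) {F : normedModType R}.
Variable T : {linear Lip0 x0 -> dual F}.
Hypothesis T_isometry : forall f, `|T f| = `|f|.
Context (U : set_system (seq M)) {PU : ProperFilter U}.
Hypothesis Ufin : forall x, \forall S \near U, x \in S.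
Variables (v : seq M -> M -> R) (h : M -> R) (C r : R).
Hypothesis C0 : 0 < C.
Hypothesis r0 : 0 < r.
Hypothesis vh : wlim T U v h.
Hypothesis hC : lip C h.
Hypothesis vC : \forall S \near U, lip C (v S).

(** Each fixed ball of radius [r] is eventually in the zero set of the family, so
    the limit is constant on balls of radius [r / 2]; and any two
    given points are eventually zeros, as [scale_induction] requires. *)
Lemma wlim_vanishing_near_points :
  (\forall S \near U, forall s x, s \in S -> mdist s x <= r -> v S x = 0) ->
  forall x y, h x = h y.
Proof.
move=> v0; have r2 : 0 < r / 2 by rewrite divr_gt0.
apply: (scale_induction T_isometry C0 vh hC vC r2).
- by move=> x y; rewrite le_max lexx orbT.
- move=> x y xy; apply: (wlim_local T_isometry (ltW C0) vh hC vC xy).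
  apply: filterS2 v0 (Ufin x) => S Sv Sx a xa; apply: (Sv x) => //.
  by move: xa; rewrite mulrC divfK.
move=> p q eta eta0; near=> S.
have vSC : lip C (v S) by near: S.
have vS0 : forall s x, s \in S -> mdist s x <= r -> v S x = 0 by near: S.
have pS : p \in S by near: S.
have qS : q \in S by near: S.
have vs0 s : s \in S -> v S s = 0.
  by move=> sS; apply: (vS0 s) => //; rewrite mdistxx ltW.
have H a : `|v S a| <= C * Num.min (mdist a p) (mdist a q).
  have := vSC a p; have := vSC a q; rewrite (vs0 _ pS) (vs0 _ qS) !subr0.
  by case: (leP (mdist a p) (mdist a q)).
move=> a b; apply: (le_trans (ler_normB _ _)); rewrite mulrDr.
by have := H a; have := H b; lra.
Unshelve. all: by end_near. Qed.

End Tightness.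

(** * Cutoff functions *)

Section Cutoffs.
Context {R : realType} {M : metricType R}.

Definition tent (z : M) (r : R) (a : M) : R :=
  Num.max 0 (Num.min 1 (2 - mdist a z / r)).

Lemma tent_ge0 z r a : 0 <= tent z r a.
Proof. by rewrite /tent le_max lexx. Qed.

Lemma tent_le1 z r a : tent z r a <= 1.
Proof. by rewrite /tent ge_max ler01 ge_min lexx. Qed.

Lemma tent_eq1 z r a : 0 < r -> mdist a z <= r -> tent z r a = 1.
Proof.
move=> r0 az; rewrite /tent (min_idPl _) ?(max_idPr _)//.
have : mdist a z / r <= 1 by rewrite ler_pdivrMr// mul1r.
lra.
Qed.

Lemma tent_support z r a : 0 < r -> tent z r a != 0 -> mdist a z <= 2 * r.
Proof.
move=> r0; apply: contraNT; rewrite -ltNge => az.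
rewrite /tent (max_idPl _)// ge_min; apply/orP; right.
have : 2 <= mdist a z / r by rewrite ler_pdivlMr// ltW.
lra.
Qed.

Lemma lip_tent z r : 0 < r -> lip r^-1 (tent z r).
Proof.
move=> r0; have ri : 0 <= r^-1 by rewrite invr_ge0 ltW.
apply: lip_max; first exact: lip_cst.
apply: lip_min; first exact: lip_cst.
apply: (@lip_le _ _ (0 + r^-1)); first by rewrite add0r.
apply: lipB; first exact: lip_cst.
have := lipZ r^-1 (lip_mdist z); rewrite mulr1 ger0_norm// => H a b.
by have := H a b; rewrite !(mulrC r^-1).
Qed.

(** Only the values of [f] on the support of [w] enter the bound: a steep cutoff
    costs little when [f] is small where it is kept. *)
Lemma lip_mul (w f : M -> R) (k l a : R) : 0 <= l -> 0 <= k -> 0 <= a ->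
  (forall x, `|w x| <= 1) -> lip l w -> lip k f ->
  (forall x, w x != 0 -> `|f x| <= a) -> lip (k + a * l) (fun x => w x * f x).
Proof.
move=> l0 k0 a0 w1 wl fk fa.
have H x y : w y != 0 -> `|w x * f x - w y * f y| <= (k + a * l) * mdist x y.
  move=> wy.
  rewrite (_ : _ - _ = w x * (f x - f y) + f y * (w x - w y)); last by ring.
  rewrite (le_trans (ler_normD _ _))// !normrM mulrDl; apply: lerD.
    by rewrite -[leRHS]mul1r; apply: ler_pM.
  by rewrite -mulrA; apply: ler_pM => //; exact: fa.
move=> x y; have [wy|wy] := eqVneq (w y) 0; last exact: H.
have [wx|wx] := eqVneq (w x) 0; last by rewrite distrC metric_sym; exact: H.
by rewrite wx wy !mul0r subrr normr0 mulr_ge0 ?mdist_ge0// addr_ge0// mulr_ge0.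
Qed.

End Cutoffs.

(** * Detours around a point *)

Section Detours.
Context {R : realType} {M : metricType R}.
Implicit Types (x y z p q : M) (rho : R).

(** A step that is shorter by [2 * rho] than the way through [z]. Then it is also
    no longer than any way through the ball of radius [rho] about [z], even when
    the space contains no path from [x] to [y]. *)
Definition detour z rho : rel M :=
  fun x y => mdist x y + 2 * rho <= mdist x z + mdist z y.

Definition conn_at z rho x y :=
  exists s, path (detour z rho) x s /\ last x s = y.

Definition conn z x y := exists2 rho : R, 0 < rho & conn_at z rho x y.

Lemma detour_sym z rho : symmetric (detour z rho).
Proof.
by move=> x y; rewrite /detour (metric_sym x y) (metric_sym x z) (metric_sym z y)
  [mdist z x + _]addrC.
Qed.

Lemma conn_at_refl z rho x : conn_at z rho x x.
Proof. by exists [::]. Qed.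

Lemma conn_at_step z rho x y : detour z rho x y -> conn_at z rho x y.
Proof. by move=> h; exists [:: y]; rewrite /= h. Qed.

Lemma conn_at_trans z rho y x w :
  conn_at z rho x y -> conn_at z rho y w -> conn_at z rho x w.
Proof.
move=> [s [ps <-]] [s' [ps' <-]]; exists (s ++ s').
by rewrite cat_path ps last_cat.
Qed.

Lemma conn_at_sym z rho x y : conn_at z rho x y -> conn_at z rho y x.
Proof.
move=> [s [ps <-]]; elim: s x ps => [|y' s IH] x /=; first by move=> _; exact: conn_at_refl.
move=> /andP[xy /IH h]; apply: conn_at_trans h _.
by apply: conn_at_step; rewrite detour_sym.
Qed.

Lemma conn_at_sub z z' rho rho' x y :
  (forall a b, detour z rho a b -> detour z' rho' a b) ->
  conn_at z rho x y -> conn_at z' rho' x y.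
Proof. by move=> h [s [ps <-]]; exists s; split => //; apply: sub_path ps. Qed.

Lemma conn_at_le z rho rho' x y : rho' <= rho ->
  conn_at z rho x y -> conn_at z rho' x y.
Proof. by move=> h; apply: conn_at_sub => a b; rewrite /detour; lra. Qed.

Lemma conn_at_near z z' rho x y : mdist z z' <= rho / 2 ->
  conn_at z rho x y -> conn_at z' (rho / 2) x y.
Proof.
move=> zz; apply: conn_at_sub => a b; rewrite /detour.
have := metric_triangle a z' z; have := metric_triangle z z' b.
by rewrite (metric_sym z' z); lra.
Qed.

Lemma conn_refl z x : conn z x x.
Proof. by exists 1 => //; exact: conn_at_refl. Qed.

Lemma conn_sym z x y : conn z x y -> conn z y x.
Proof. by move=> [rho r0 /conn_at_sym h]; exists rho. Qed.

Lemma conn_trans z y x w : conn z x y -> conn z y w -> conn z x w.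
Proof.
move=> [r1 r10 h1] [r2 r20 h2].
exists (Num.min r1 r2); first by rewrite lt_min r10.
apply: (@conn_at_trans _ _ y); first by apply: conn_at_le h1; rewrite ge_min lexx.
by apply: conn_at_le h2; rewrite ge_min lexx orbT.
Qed.

(** A step that ends at [z] is not shorter than the way through [z]. *)
Lemma not_conn_self z p : conn z p z -> p = z.
Proof.
move=> [rho rho0 [s]]; elim/last_ind: s => [|s x _] [] //.
rewrite rcons_path last_rcons => /andP[_ h] xz.
by exfalso; move: h; rewrite xz /detour mdistxx lerD2l; lra.
Qed.

(** If the way through [z] were longer, then the direct step from [x] to [y] would
    be a detour. So points that [z] separates sit as in a tree, with [z] exactly
    on the way from one to the other. *)
Lemma cut_between z p x y : conn z p x -> ~ conn z p y ->
  mdist x y = mdist x z + mdist z y.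
Proof.
move=> px py; apply/eqP; rewrite eq_le metric_triangle/=.
apply/ler_addgt0Pr => /= e e0; rewrite leNgt; apply/negP => H; apply: py.
apply: conn_trans px _; exists (e / 2); first by rewrite divr_gt0.
by apply: conn_at_step; rewrite /detour; lra.
Qed.

End Detours.

(** * Pairs without intermediate cut points *)

Section Peeling.
Context {R : realType} {M : metricType R} (x0 : M) {F : normedModType R}.
Variable T : {linear Lip0 x0 -> dual F}.
Hypothesis T_isometry : forall f, `|T f| = `|f|.
Hypothesis T_surjective : forall phi : dual F, exists f, T f = phi.
Context {I : Type} (U : set_system I) {UU : UltraFilter U}.

Definition vanishing (u : I -> M -> R) :=
  forall eta : R, 0 < eta -> \forall i \near U, forall a, `|u i a| <= eta.

(** The product of [u] with a tent over the ball has a limit [h1], to which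
    [wlim_small_support] applies; what is left vanishes on the ball and has limit
    [k := h - h1]. *)
Lemma split_ball (u : I -> M -> R) (h : M -> R) (C s : R) (z : M) :
  0 < s -> 0 < C -> wlim T U u h -> lip C h ->
  (\forall i \near U, lip C (u i)) -> vanishing u ->
  exists v k, [/\ wlim T U v k, lip (2 * C + 1) k,
    \forall i \near U, lip (2 * C + 1) (v i), vanishing v &
    (\forall i \near U, forall a, v i a != 0 -> u i a != 0 /\ s < mdist a z) /\
    forall x y, `|(h x - h y) - (k x - k y)| <= (C + 1) * (mdist x y -
      Num.min (mdist x y) (Num.max 0 (mdist x z - 3 * s) + Num.max 0 (mdist y z - 3 * s)))].
Proof.
move=> s0 C0 uh hC uC u0.
pose v1 i a := tent z s a * u i a.
have v1abs i a : `|v1 i a| <= `|u i a|.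
  rewrite /v1 normrM ler_piMl// ger0_norm ?tent_ge0//; exact: tent_le1.
have v1C : \forall i \near U, lip (C + 1) (v1 i).
  (* u is eventually bounded by s, so the slope 1 / s of the tent contributes 1 *)
  have s1 : (1 : R) = s * s^-1 by rewrite divff// gt_eqF.
  apply: filterS2 uC (u0 s s0) => i uiC uis.
  rewrite s1; apply: lip_mul; rewrite ?invr_ge0 ?(ltW s0) ?(ltW C0)//.
  - by move=> x; rewrite ger0_norm ?tent_ge0// tent_le1.
  - exact: lip_tent.
have C1 : 0 <= C + 1 by lra.
have [h1 [h1C _ v1h1]] := wlim_exists T_isometry T_surjective UU C1 v1C.
pose v i a := u i a - v1 i a; pose k a := h a - h1 a.
have uC' : \forall i \near U, lip (C + 1) (u i).
  by apply: filterS uC => i; apply: lip_le; lra.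
have hC' : lip (C + 1) h by apply: lip_le hC; lra.
have eC : C + (C + 1) = 2 * C + 1 by ring.
exists v, k; split.
- exact: (wlimB _ uh v1h1 hC' h1C uC' v1C).
- by rewrite -eC; exact: lipB.
- by apply: filterS2 uC v1C => i ? ?; rewrite -eC; exact: lipB.
- move=> eta eta0; apply: filterS (u0 eta eta0) => i ui a.
  rewrite /v /v1 -{1}[u i a]mul1r -mulrBl normrM.
  apply: le_trans (ui a); rewrite ler_piMl//.
  by have := tent_ge0 z s a; have := tent_le1 z s a; rewrite ler_norml; lra.
split.
  apply: nearW => i a va; split.
    by apply: contraNneq va => e; rewrite /v /v1 e mulr0 subrr.
  rewrite ltNge; apply: contraNN va => az.
  by rewrite /v /v1 tent_eq1// mul1r subrr.
move=> x y; rewrite (_ : _ - _ = h1 x - h1 y); last by rewrite /k; ring.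
have -> : 3 * s = 2 * s + s by ring.
apply: (wlim_small_support T_isometry C1 v1h1 h1C v1C).
- apply: nearW => i a; rewrite /v1 mulf_eq0 negb_or => /andP[? _].
  exact: tent_support.
- exact: ltW.
- have : 0 < (C + 1) * s by rewrite mulr_gt0//; lra.
  move=> /u0; apply: filterS => i ui a; exact: le_trans (v1abs i a) (ui a).
Qed.

(** The balls around the points of [l] are removed one at a time. Removing a ball
    does not change the increment of the limit along a detour around it, hence
    along a chain of detours from [p] to [q]; when no ball is left the functions
    are zero. *)
Lemma wlim_invisible_cover (r : R) (p q : M) (l : seq M) : 0 < r ->
  (forall x, x \in l -> conn_at x (6 * r) p q) ->
  forall (C : R) u h, 0 < C -> wlim T U u h -> lip C h ->
  (\forall i \near U, lip C (u i)) -> vanishing u ->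
  (\forall i \near U, forall a, u i a != 0 -> exists2 x, x \in l & mdist a x <= 2 * r) ->
  h p = h q.
Proof.
move=> r0; elim: l => [|z l IH] lconn C u h C0 uh hC uC u0 usupp.
  apply: (wlim_local T_isometry (ltW C0) uh hC uC (lexx _)).
  apply: filterS usupp => i ui x _; apply/eqP/negPn/negP => /ui[? ].
  by rewrite in_nil.
have r20 : 0 < 2 * r by lra.
have [v [k [vk kC vC v0 [vsupp vk1]]]] := @split_ball u h C (2 * r) z r20 C0 uh hC uC u0.
have C1 : 0 < 2 * C + 1 by lra.
have kpq : k p = k q.
  apply: (IH _ (2 * C + 1) v) => //.
    by move=> x xl; apply: lconn; rewrite inE xl orbT.
  apply: filterS2 vsupp usupp => i vi ui a /vi [/ui [x]].
  rewrite inE => /orP[/eqP -> h1 h2|]; last by exists x.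
  lra.
have step x y : detour z (6 * r) x y -> h x - h y = k x - k y.
  move=> fxy; apply/eqP; rewrite -subr_eq0 -normr_le0.
  apply: (le_trans (vk1 x y)); rewrite (min_idPl _) ?subrr ?mulr0//.
  have := fxy; rewrite /detour (metric_sym z y) => {}fxy.
  have h1 : mdist x z - 3 * (2 * r) <= Num.max 0 (mdist x z - 3 * (2 * r)).
    by rewrite le_max lexx orbT.
  have h2 : mdist y z - 3 * (2 * r) <= Num.max 0 (mdist y z - 3 * (2 * r)).
    by rewrite le_max lexx orbT.
  lra.
have [s [ps sq]] := lconn z (mem_head _ _).
suff H x : path (detour z (6 * r)) x s -> h x - h (last x s) = k x - k (last x s).
  by have := H p ps; rewrite sq; lra.
elim: s x {ps sq} => [|y s IHs] x /=; first by rewrite !subrr.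
move=> /andP[/step xy /IHs]; lra.
Qed.

End Peeling.

Definition complete_metric {R : realType} (M : metricType R) :=
  forall x : nat -> M,
    (forall e : R, 0 < e -> exists n0, forall m n, (n0 <= m)%N -> (n0 <= n)%N ->
      mdist (x m) (x n) < e) ->
    exists z, forall e : R, 0 < e -> exists n0, forall n, (n0 <= n)%N ->
      mdist (x n) z < e.

Lemma ultra_pigeonhole (I : Type) (A : eqType) (U : set_system I) (l : seq A)
    (P : A -> I -> Prop) : UltraFilter U ->
  (\forall i \near U, exists2 s, s \in l & P s i) ->
  exists2 s, s \in l & \forall i \near U, P s i.
Proof.
move=> UU; elim: l => [|s l IH] H.
  by have [i [s]] := filter_ex H; rewrite in_nil.
have [Us|Us] := in_ultra_setVsetC [set i | P s i] UU.
  by exists s => //; exact: mem_head.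
have [|t tl Ut] := IH; last by exists t => //; rewrite inE tl orbT.
apply: filterS2 H Us => i [t]; rewrite inE => /orP[/eqP -> //|tl Pt] _.
by exists t.
Qed.

Section NoCutPoint.
Context {R : realType} {M : metricType R} (x0 : M) {F : normedModType R}.
Variable T : {linear Lip0 x0 -> dual F}.
Hypothesis T_isometry : forall f, `|T f| = `|f|.
Hypothesis T_surjective : forall phi : dual F, exists f, T f = phi.
Hypothesis Mcomplete : complete_metric M.
Context (U : set_system nat) {UU : UltraFilter U}.
Hypothesis Uoo : forall n, \forall k \near U, (n <= k)%N.

Variables (r : nat -> R) (net : nat -> seq M) (reg : nat -> set M).
Hypothesis r_gt0 : forall n, 0 < r n.
Hypothesis r_decr : forall m n, (m <= n)%N -> r n <= r m.
Hypothesis r_cvg0 : forall e : R, 0 < e -> exists n, r n < e.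
Hypothesis reg_decr : forall m n, (m <= n)%N -> reg n `<=` reg m.
Hypothesis reg_net : forall n a, reg n a -> exists2 x, x \in net n & mdist a x <= 2 * r n.

(** For each scale the ultrafilter selects a single point of the finite net, near
    to most of the [y k]; the selected points form a Cauchy sequence. *)
Lemma net_cluster (y : nat -> M) :
  (forall j k, (j <= k)%N -> exists2 s, s \in net j & mdist (y k) s <= 4 * r j) ->
  exists z, forall (e : R) n, 0 < e -> exists2 k, (n <= k)%N & mdist (y k) z < e.
Proof.
move=> yS.
have /choice[s hs] j : exists s, \forall k \near U, mdist (y k) s <= 4 * r j.
  have [|s _ hs] := @ultra_pigeonhole nat M U (net j) (fun s k => mdist (y k) s <= 4 * r j) UU.
    by apply: filterS (Uoo j) => k /yS [s ? ?]; exists s.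
  by exists s.
have [e e0|z hz] := Mcomplete (x := s).
  have [n0 hn0] := r_cvg0 (divr_gt0 e0 (ltr0n R 8)).
  exists n0 => m n mn nn.
  have [k [km kn]] := filter_ex (filterI (hs m) (hs n)).
  have := metric_triangle (s m) (y k) (s n); rewrite (metric_sym (s m) (y k)).
  have := r_decr mn; have := r_decr nn; lra.
exists z => e n e0.
have [n0 hn0] := hz (e / 2) (divr_gt0 e0 (ltr0n R 2)).
have [n1 hn1] := r_cvg0 (divr_gt0 e0 (ltr0n R 8)).
pose m := maxn n0 n1.
have [k [km kn]] := filter_ex (filterI (hs m) (Uoo n)).
exists k => //; have := metric_triangle (y k) (s m) z.
have := hn0 m (leq_maxl _ _); have := r_decr (leq_maxr n0 n1); rewrite -/m; lra.
Qed.

Variables (g : nat -> M -> R) (h : M -> R) (C : R).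
Hypothesis C0 : 0 < C.
Hypothesis gh : wlim T U g h.
Hypothesis hC : lip C h.
Hypothesis gC : forall n, lip C (g n).
Hypothesis g_supp : forall n a, g n a != 0 -> reg n a.
Hypothesis g_small : forall n a, `|g n a| <= 2 * r n.

Lemma g_vanishing : vanishing U g.
Proof.
move=> eta eta0; have [n hn] := r_cvg0 (divr_gt0 eta0 (ltr0n R 2)).
apply: filterS (Uoo n) => k nk a; apply: (le_trans (g_small k a)).
by have := r_decr nk; lra.
Qed.

(** If the points of the regions which cannot be bypassed stayed away from [p] and
    [q] at all scales, they would cluster at a point [z]. But [z] is bypassed by
    a chain with a fixed margin, and so are the points near it. *)
Lemma visible_scale (p q : M) (rho : R) : 0 < rho ->
  (forall z, z != p -> z != q -> conn z p q) ->
  exists m, r m <= rho / 2 /\ forall x, x \in net m ->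
    (exists2 a, reg m a & mdist a x <= 2 * r m) ->
    [\/ mdist x p <= rho, mdist x q <= rho | conn_at x (6 * r m) p q].
Proof.
move=> rho0 pq; apply: contrapT => H.
have [m0 hm0] := r_cvg0 (divr_gt0 rho0 (ltr0n R 2)).
have /choice[y hy] k : exists y, [/\ exists2 a, reg (m0 + k)%N a & mdist a y <= 2 * r (m0 + k),
    rho < mdist y p, rho < mdist y q & ~ conn_at y (6 * r (m0 + k)) p q].
  apply: contrapT => Hk; apply: H; exists (m0 + k)%N; split.
    by have := r_decr (leq_addr k m0); lra.
  move=> x xS xN; apply: contrapT => Hx; apply: Hk; exists x; split => //.
  - by rewrite ltNge; apply/negP => ?; apply: Hx; apply: Or31.
  - by rewrite ltNge; apply/negP => ?; apply: Hx; apply: Or32.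
  - by move=> ?; apply: Hx; apply: Or33.
have [|z hz] := net_cluster (y := y).
  move=> j k jk; have [[a Na ay] _ _ _] := hy k.
  have jmk : (j <= m0 + k)%N by rewrite (leq_trans jk)// leq_addl.
  have [s sS as_] := reg_net (reg_decr jmk Na).
  exists s => //; have := metric_triangle (y k) a s.
  by have := r_decr jmk; rewrite (metric_sym (y k) a); lra.
have [rp | zp] := eqVneq z p.
  have [k _] := hz rho 0%N rho0; have [_ + _ _] := hy k; rewrite rp; lra.
have [rq | zq] := eqVneq z q.
  have [k _] := hz rho 0%N rho0; have [_ _ + _] := hy k; rewrite rq; lra.
have [e e0 ez] := pq z zp zq.
have e2 : 0 < e / 2 by rewrite divr_gt0.
have [n1 hn1] := r_cvg0 (divr_gt0 e0 (ltr0n R 12)).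
have [k nk kz] := hz _ n1 e2; have [_ _ _ []] := hy k.
apply: (@conn_at_le _ _ _ (e / 2)).
  by have := r_decr (leq_trans nk (leq_addl m0 k)); lra.
by apply: conn_at_near ez; rewrite metric_sym ltW.
Qed.

(** Balls of radius comparable to [rho] about [p] and [q] are removed by hand,
    which costs [O(rho)] each; the rest of the supports is covered by small balls
    that can be bypassed. *)
Lemma wlim_no_cut_point (p q : M) :
  (forall z, z != p -> z != q -> conn z p q) -> h p = h q.
Proof.
move=> pq; apply/eqP; rewrite -subr_eq0 -normr_le0; apply/ler_addgt0Pr => /= e e0.
rewrite add0r; pose K := 12 * (3 * C + 3).
have C00 : 0 < C by exact: C0.
have K0 : 0 < K by rewrite /K mulr_gt0//; lra.
have rho0 : 0 < e / K by rewrite divr_gt0.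
have eK : K * (e / K) = e by rewrite mulrC divfK// gt_eqF.
move: (e / K) rho0 eK => rho rho0 eK.
have [m [rm hm]] := visible_scale rho0 pq.
have s0 : 0 < 2 * rho by lra.
have gC' : \forall n \near U, lip C (g n) by exact: nearW.
have [v1 [k1 [vk1 k1C v1C v10 [v1supp b1]]]] :=
  @split_ball _ _ _ _ _ T_isometry T_surjective _ U UU g h C (2 * rho) p s0 C0 gh hC gC' g_vanishing.
have C1 : 0 < 2 * C + 1 by lra.
have [v2 [k2 [vk2 k2C v2C v20 [v2supp b2]]]] :=
  @split_ball _ _ _ _ _ T_isometry T_surjective _ U UU v1 k1 (2 * C + 1) (2 * rho) q s0 C1 vk1 k1C v1C v10.
have C2 : 0 < 2 * (2 * C + 1) + 1 by lra.
pose l := [seq x <- net m | `[< conn_at x (6 * r m) p q >]].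
have k2pq : k2 p = k2 q.
  apply: (@wlim_invisible_cover _ _ _ _ _ T_isometry T_surjective _ U UU (r m) p q l _ _ _ v2 k2 C2) => //.
    by move=> x; rewrite mem_filter => /andP[/asboolP].
  apply: filterS3 v1supp v2supp (Uoo m) => n s1 s2 mn a /s2 [/s1 [ga ap] aq].
  have Na := reg_decr mn (g_supp ga).
  have [x xS ax] := reg_net Na; exists x => //.
  rewrite mem_filter xS andbT; apply/asboolP.
  have [||//] := hm x xS (ex_intro2 _ _ a Na ax).
  - by move=> xp; exfalso; have := metric_triangle a x p; lra.
  - by move=> xp; exfalso; have := metric_triangle a x q; lra.
have near6 z : mdist p q - Num.min (mdist p q) (Num.max 0 (mdist p z - 3 * (2 * rho)) +
    Num.max 0 (mdist q z - 3 * (2 * rho))) <= 12 * rho.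
  rewrite lerBlDr -lerBlDl le_min; apply/andP; split; first lra.
  have h1 : mdist p z - 3 * (2 * rho) <= Num.max 0 (mdist p z - 3 * (2 * rho)).
    by rewrite le_max lexx orbT.
  have h2 : mdist q z - 3 * (2 * rho) <= Num.max 0 (mdist q z - 3 * (2 * rho)).
    by rewrite le_max lexx orbT.
  have := metric_triangle p z q; rewrite (metric_sym z q); lra.
have c1 := le_trans (b1 p q) (ler_wpM2l (ltW (addr_gt0 C0 ltr01)) (near6 p)).
have c2 := le_trans (b2 p q) (ler_wpM2l (ltW (addr_gt0 C1 ltr01)) (near6 q)).
rewrite k2pq subrr subr0 in c2.
have c3 := ler_normD (h p - h q - (k1 p - k1 q)) (k1 p - k1 q).
rewrite subrK in c3.
by rewrite /K in eK; lra.
Qed.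

End NoCutPoint.

(** * The set of cut points of a pair *)

Section CutPoints.
Context {R : realType} {M : metricType R}.
Variables p q : M.
Hypothesis pq : p != q.

Definition cut_point z := ~ conn z p q.

Lemma conn_open z x : conn z p x ->
  exists2 e : R, 0 < e & forall z', mdist z z' < e -> conn z' p x.
Proof.
move=> [rho rho0 h]; have r2 : 0 < rho / 2 by rewrite divr_gt0.
exists (rho / 2) => // z' zz'; exists (rho / 2) => //.
by apply: conn_at_near h; exact: ltW.
Qed.

Lemma cut_source : cut_point p.
Proof. by move=> /conn_sym/not_conn_self qp; have := pq; rewrite qp eqxx. Qed.

Lemma cut_target : cut_point q.
Proof. by move=> /not_conn_self e; have := pq; rewrite e eqxx. Qed.

Lemma cut_dist z : cut_point z -> mdist p q = mdist p z + mdist z q.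
Proof. by move=> /(cut_between (conn_refl z p)). Qed.

(** Distances between cut points are differences of distances to [p]: the nearer
    point separates the farther one from [p] or from [q], and [cut_between]
    applies in both cases. *)
Lemma cut_isometry z z' : cut_point z -> cut_point z' -> mdist p z <= mdist p z' ->
  mdist z z' = mdist p z' - mdist p z.
Proof.
move=> cz cz' le_t; have [pz'|pz'] := pselect (conn z p z').
  have := cut_between pz' cz; have := cut_dist cz; have := cut_dist cz'.
  by have := mdist_ge0 z z'; rewrite (metric_sym z' z); lra.
by have := cut_between (conn_refl z p) pz'; lra.
Qed.

Lemma cut_before z z' : cut_point z -> cut_point z' -> mdist p z < mdist p z' -> conn z' p z.
Proof.
move=> cz cz' lt_t; apply: contrapT => pz.
by have := cut_between (conn_refl z' p) pz; have := mdist_ge0 z' z; lra.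
Qed.

Lemma cut_after z z' : cut_point z -> cut_point z' -> mdist p z < mdist p z' -> ~ conn z p z'.
Proof.
move=> cz cz' lt_t pz'; have := cut_between pz' cz.
have := cut_dist cz; have := cut_dist cz'; have := mdist_ge0 z' z; lra.
Qed.

(** Cut points are passed in the order of their distance to [p]: if [z'] did
    separate [p] from [x], a way from [p] to [x] would have to reach [z'] and come
    back through [z], which is too long. *)
Lemma conn_mono z z' x : cut_point z -> cut_point z' -> mdist p z < mdist p z' ->
  conn z p x -> conn z' p x.
Proof.
move=> cz cz' lt_t zx; apply: contrapT => z'x.
have h1 := cut_between (conn_refl z' p) z'x.
have h2 := cut_between zx (cut_after cz cz' lt_t).
have h3 := cut_isometry cz cz' (ltW lt_t).
have := metric_triangle p z x; rewrite (metric_sym z x) (metric_sym z' x) in h1 *.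
lra.
Qed.

(** A cut point [w] of the pair [z], [z'] lies on the way between them, so [z] is
    reached from [p], and [q] from [z'], without passing [w]; then [w] is a cut
    point of [p] and [q] inside the gap. *)
Lemma gap_no_cut z z' : cut_point z -> cut_point z' -> mdist p z < mdist p z' ->
  (forall w, cut_point w -> ~ (mdist p z < mdist p w < mdist p z')) ->
  forall w, w != z -> w != z' -> conn w z z'.
Proof.
move=> cz cz' lt_t gap w wz wz'; apply: contrapT => nw.
have wd : mdist z z' = mdist z w + mdist w z' by exact: (cut_between (conn_refl w z)).
have zz := cut_isometry cz cz' (ltW lt_t).
have dz := cut_dist cz; have dz' := cut_dist cz'.
have wz0 : 0 < mdist z w by rewrite mdist_gt0 eq_sym.
have wz'0 : 0 < mdist w z' by rewrite mdist_gt0.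
have pw1 : conn w p z.
  exists (mdist z w) => //; apply: conn_at_step; rewrite /detour /=.
  have h1 := metric_triangle p w z'; have h2 := metric_sym w z; lra.
have qw1 : conn w z' q.
  exists (mdist w z') => //; apply: conn_at_step; rewrite /detour /=.
  have := metric_triangle z w q; have := metric_sym z' w; lra.
have cw : cut_point w.
  move=> pwq; apply: nw; apply: conn_trans (conn_sym pw1) _.
  exact: conn_trans pwq (conn_sym qw1).
apply: (gap w cw).
have [h|h] := leP (mdist p w) (mdist p z).
  exfalso; have := cut_isometry cw cz h; rewrite (metric_sym w z) => h1.
  by have := cut_isometry cw cz' (le_trans h (ltW lt_t)); lra.
have [h'|//] := leP (mdist p z') (mdist p w).
exfalso; have := cut_isometry cz' cw h'; rewrite (metric_sym z' w) => h1.
by have := cut_isometry cz cw (ltW h); lra.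
Qed.

Hypothesis Mcomplete : complete_metric M.

(** Cut points with converging distances to [p] form a Cauchy sequence by
    [cut_isometry], and being bypassed is an open condition on [z]. *)
Lemma cut_closed x (s : R) :
  (forall e : R, 0 < e -> exists z, [/\ cut_point z, ~ conn z p x & `|mdist p z - s| < e]) ->
  exists z, [/\ cut_point z, ~ conn z p x & mdist p z = s].
Proof.
move=> H.
have /choice[z hz] n : exists z, [/\ cut_point z, ~ conn z p x & `|mdist p z - s| < n.+1%:R^-1].
  by apply: H; rewrite invr_gt0.
have small (e : R) : 0 < e -> exists n0, forall n, (n0 <= n)%N -> n.+1%:R^-1 < e.
  move=> e0; exists (Num.bound e^-1) => n nn.
  rewrite invf_plt ?posrE//; apply: lt_le_trans (archi_boundP _) _.
    by rewrite invr_ge0 ltW.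
  by rewrite ler_nat (leq_trans nn).
have dz m n : mdist (z m) (z n) = `|mdist p (z m) - mdist p (z n)|.
  have [cm _ _] := hz m; have [cn _ _] := hz n.
  have [le|/ltW le] := leP (mdist p (z m)) (mdist p (z n)).
    by rewrite (cut_isometry cm cn le) distrC ger0_norm// subr_ge0.
  by rewrite metric_sym (cut_isometry cn cm le) ger0_norm// subr_ge0.
have [e e0|w hw] := Mcomplete (x := z).
  have [n0 hn0] := small (e / 2) (divr_gt0 e0 (ltr0n R 2)).
  exists n0 => m n /hn0 mn /hn0 nn; rewrite dz.
  have [_ _ hm] := hz m; have [_ _ hn] := hz n.
  rewrite (_ : _ - _ = (mdist p (z m) - s) - (mdist p (z n) - s)); last by ring.
  apply: le_lt_trans (ler_normB _ _) _.
  by rewrite (splitr e) ltrD ?(lt_trans hm mn) ?(lt_trans hn nn).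
have nconn y : (forall n, ~ conn (z n) p y) -> ~ conn w p y.
  move=> hy /conn_open [e e0 he]; have [n0 hn0] := hw e e0.
  by apply: (hy n0); apply: he; rewrite metric_sym hn0.
exists w; split.
- by apply: nconn => n; have [] := hz n.
- by apply: nconn => n; have [] := hz n.
apply/eqP; rewrite -subr_eq0 -normr_le0; apply/ler_addgt0Pr => /= e e0; rewrite add0r.
have [n0 hn0] := small (e / 2) (divr_gt0 e0 (ltr0n R 2)).
have [n1 hn1] := hw (e / 2) (divr_gt0 e0 (ltr0n R 2)).
pose n := maxn n0 n1.
have [_ _ h1] := hz n; have h2 := hn0 n (leq_maxl _ _); have h3 := hn1 n (leq_maxr _ _).
rewrite (_ : _ - _ = (mdist p (z n) - s) - (mdist p (z n) - mdist p w)); last by ring.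
apply: le_trans (ler_normB _ _) _.
have := lip_mdist p (z n) w; rewrite mul1r (metric_sym (z n) p) (metric_sym w p) => h4.
have h5 := lt_trans h1 h2.
rewrite (splitr e) lerD ?(ltW h5)//; exact: ltW (le_lt_trans h4 h3).
Qed.

End CutPoints.

(** * Cheapest routes on a subset of the line *)

Section Potential.
Context {R : realType}.
Variables (T : set R) (l0 lam V : R) (gam : nat -> R -> R).
Hypothesis T0 : T 0.
Hypothesis T_ge0 : forall t, T t -> 0 <= t.
Hypothesis Tl : T l0.
Hypothesis gam_lip : forall n s t, T s -> T t -> s <= t ->
  `|gam n s - gam n t| <= lam * (t - s).
Hypothesis gam_var : forall k (s : seq R), path <=%R 0 s -> {in s, forall t, T t} ->
  \sum_(n < k) chain_cost (fun a b => `|gam n a - gam n b|) 0 s <= V.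

Definition gap (s t : R) := s < t /\ forall u, T u -> ~ (s < u < t).

(** The share of the slope [lam] that the function [gam n] leaves unused on the
    step. Steps over a gap of [T] may also be taken for free. *)
Definition step_cost (lab : option nat) (s t : R) : R :=
  if lab is Some n then lam * (t - s) - `|gam n s - gam n t| else 0.

Fixpoint route_cost (s : R) (w : seq (option nat * R)) : R :=
  if w is (lab, t) :: w' then step_cost lab s t + route_cost t w' else 0.

Fixpoint route (s : R) (w : seq (option nat * R)) : Prop :=
  if w is (lab, t) :: w' then
    [/\ T t, s <= t, (lab = None -> gap s t) & route t w'] else True.

Definition route_end (s : R) (w : seq (option nat * R)) := last s (map snd w).

Lemma step_cost_ge0 lab s t : T s -> T t -> s <= t -> 0 <= step_cost lab s t.
Proof. by move=> Ts Tt st; case: lab => //= n; rewrite subr_ge0 gam_lip. Qed.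

Lemma route_cost_ge0 s w : T s -> route s w -> 0 <= route_cost s w.
Proof.
elim: w s => [//|[lab t] w IH] s Ts /= [Tt st _ rw].
by rewrite addr_ge0 ?step_cost_ge0 ?IH.
Qed.

Lemma route_cat s w lab t : route s w -> T t -> route_end s w <= t ->
  (lab = None -> gap (route_end s w) t) ->
  [/\ route s (rcons w (lab, t)), route_end s (rcons w (lab, t)) = t &
    route_cost s (rcons w (lab, t)) = route_cost s w + step_cost lab (route_end s w) t].
Proof.
elim: w s => [|[lab' t'] w IH] s /=; first by rewrite addr0 add0r.
move=> [Tt' st' h rw] Tt le gp; have [r1 r2 r3] := IH t' rw Tt le gp.
by split => //; rewrite r3 addrA.
Qed.

(** A free step has no point of [T] strictly inside, so a route is cut either
    between two steps or inside a labelled one; the latter becomes no more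
    expensive since [gam n] is [lam]-Lipschitz. *)
Lemma route_truncate a s w : T a -> T s -> route a w -> a <= s <= route_end a w ->
  exists w', [/\ route a w', route_end a w' = s & route_cost a w' <= route_cost a w].
Proof.
elim: w a => [|[lab b] w IH] a Ta Ts.
  move=> _; rewrite /route_end /= -eq_le => /eqP as_; exists [::].
  by split.
move=> /= [Tb ab gp rw] /andP[as_ sw_]; have {sw_} sw : s <= route_end b w := sw_.
have [bs|sb] := leP b s.
  have [|w' [r1 r2 r3]] := IH b Tb Ts rw; first by rewrite bs.
  by exists ((lab, b) :: w'); split => //=; rewrite lerD2l.
have rw0 := route_cost_ge0 Tb rw.
case: lab gp => [n|] gp.
  exists [:: (Some n, s)]; split => //=; rewrite addr0.
  suff : lam * (s - a) - `|gam n a - gam n s| <= lam * (b - a) - `|gam n a - gam n b| by lra.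
  have := gam_lip n Ts Tb (ltW sb); have := ler_distD (gam n s) (gam n a) (gam n b).
  by lra.
have [_ gap_ab] := gp erefl.
exists [::]; split => //=; last by rewrite add0r.
apply/eqP; rewrite eq_le; rewrite /route_end /= as_ /= leNgt; apply/negP => as1.
by apply: (gap_ab s Ts); rewrite as1.
Qed.

(** The greatest function which vanishes at 0, is constant across the gaps, and
    leaves room for every [gam n]: its sum with any of them has slope at most
    [lam]. *)
Definition potential (t : R) :=
  inf [set route_cost 0 w | w in [set w | route 0 w /\ route_end 0 w = t]].

Lemma potential_le w : route 0 w -> potential (route_end 0 w) <= route_cost 0 w.
Proof.
move=> rw; apply: ge_inf; last by exists w.
by exists 0 => _ [w' [rw' _] <-]; exact: route_cost_ge0.
Qed.

Lemma potential_glb t c : T t ->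
  (forall w, route 0 w -> route_end 0 w = t -> c <= route_cost 0 w) ->
  c <= potential t.
Proof.
move=> Tt H; apply: lb_le_inf.
  exists (route_cost 0 [:: (Some 0%N, t)]), [:: (Some 0%N, t)] => //=.
  by split => //; split => //; exact: T_ge0.
by move=> _ [w [rw we] <-]; exact: H.
Qed.

Lemma potential_step s t lab : T s -> T t -> s <= t -> (lab = None -> gap s t) ->
  potential t <= potential s + step_cost lab s t.
Proof.
move=> Ts Tt st gp; rewrite -lerBlDr; apply: potential_glb => // w rw we.
have le : route_end 0 w <= t by rewrite we.
have gp' : lab = None -> gap (route_end 0 w) t by rewrite we.
have [r1 r2 r3] := route_cat rw Tt le gp'.
by have := potential_le r1; rewrite r2 r3 we lerBlDr.
Qed.

Lemma potential_mono s t : T s -> T t -> s <= t -> potential s <= potential t.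
Proof.
move=> Ts Tt st; apply: potential_glb => // w rw we.
have [|w' [r1 <- r3]] := route_truncate T0 Ts rw; first by rewrite we st T_ge0.
exact: le_trans (potential_le r1) r3.
Qed.

Lemma potential0 : potential 0 <= 0.
Proof. exact: (@potential_le [::]). Qed.

Lemma potential_ge0 t : T t -> 0 <= potential t.
Proof. by move=> Tt; apply: potential_glb => // w rw _; exact: route_cost_ge0. Qed.

Fixpoint route_var (s : R) (w : seq (option nat * R)) : R :=
  if w is (lab, t) :: w' then
    (if lab is Some n then `|gam n s - gam n t| else 0) + route_var t w' else 0.

(** A bound for the labels that occur, so that only finitely many of the [gam n]
    have to be considered for a given route. *)
Fixpoint route_label (w : seq (option nat * R)) : nat :=
  if w is (lab, _) :: w' then
    maxn (if lab is Some n then n.+1 else 0%N) (route_label w') else 0%N.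

Lemma route_sorted s w : route s w ->
  path <=%R s (map snd w) /\ {in map snd w, forall t, T t}.
Proof.
elim: w s => [|[lab t] w IH] s //= [Tt st _ /IH[-> h]]; rewrite st; split => // u.
by rewrite inE => /orP[/eqP ->//|/h].
Qed.

Lemma route_var_sum s w k : (route_label w <= k)%N ->
  route_var s w <= \sum_(n < k) chain_cost (fun a b => `|gam n a - gam n b|) s (map snd w).
Proof.
elim: w s => [|[lab t] w IH] s /=; first by move=> _; rewrite big1.
rewrite geq_max => /andP[lk /IH h]; rewrite big_split /= lerD//.
case: lab lk => [n nk|_]; last by apply: sumr_ge0.
by rewrite (bigD1 (Ordinal nk))//= lerDl sumr_ge0.
Qed.

Lemma route_var_le w : route 0 w -> route_var 0 w <= V.
Proof.
move=> /route_sorted[p1 p2]; apply: (le_trans (route_var_sum 0 (leqnn _))).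
exact: gam_var.
Qed.

(** Along an almost cheapest route from 0 to [l0] the potential grows by the full
    slope [lam], less what the labels use. That is all that is left for [eta],
    and it adds up to the total variation of the [gam n]. *)
Lemma potential_rigid (eta : R -> R) :
  (forall s t, T s -> T t -> s <= t ->
    `|eta s - eta t| <= lam * (t - s) - (potential t - potential s)) ->
  (forall s t, T s -> T t -> gap s t -> eta s = eta t) ->
  `|eta 0 - eta l0| <= V.
Proof.
move=> eta1 eta2.
have key a w : T a -> route a w ->
    `|eta a - eta (route_end a w)| + (potential (route_end a w) - potential a)
    <= route_cost a w + route_var a w.
  elim: w a => [|[lab b] w IH] a Ta /=; first by rewrite /route_end /= !subrr normr0 !addr0.
  move=> [Tb ab gp rw]; have := IH b Tb rw; rewrite -/(route_end b w).
  have := ler_distD (eta b) (eta a) (eta (route_end b w)).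
  rewrite (_ : route_end a ((lab, b) :: w) = route_end b w)//.
  case: lab gp => [n|] gp; first by have := eta1 _ _ Ta Tb ab; rewrite /=; lra.
  rewrite (eta2 _ _ Ta Tb (gp erefl)) subrr normr0.
  have := potential_step Ta Tb ab gp; rewrite /=; lra.
apply/ler_addgt0Pr => /= e e0; rewrite leNgt; apply/negP => H.
suff : potential l0 + e <= potential l0 by lra.
apply: potential_glb => // w rw we.
have := key 0 w T0 rw; rewrite we; have := route_var_le rw.
by have := potential0; lra.
Qed.

End Potential.

(** * Averaging until the variation is small *)

Section Energy.
Context {R : realType}.
Implicit Types (gam : R -> R) (a : R) (s : seq R).

(** The Dirichlet energy of a piecewise linear interpolation. It replaces the
    variation because it is quadratic and obeys the parallelogram law. Steps of
    length 0 contribute 0, division by 0 being 0. *)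
Definition energy gam a s :=
  chain_cost (fun x y => (gam x - gam y) ^+ 2 / (y - x)) a s.

Definition chain_variation gam a s := chain_cost (fun x y => `|gam x - gam y|) a s.

(** The Cauchy-Schwarz inequality for two steps. *)
Lemma energy_step gam a b c : a <= b -> b <= c ->
  (gam a - gam c) ^+ 2 / (c - a) <=
  (gam a - gam b) ^+ 2 / (b - a) + (gam b - gam c) ^+ 2 / (c - b).
Proof.
rewrite le_eqVlt => /predU1P[->|ab]; first by rewrite subrr expr0n mul0r add0r.
rewrite le_eqVlt => /predU1P[->|bc].
  by rewrite [X in _ <= _ + X / _](_ : _ = 0) ?mul0r ?addr0// subrr expr0n.
have u0 : 0 < b - a by rewrite subr_gt0.
have v0 : 0 < c - b by rewrite subr_gt0.
have -> : c - a = (b - a) + (c - b) by ring.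
have -> : gam a - gam c = (gam a - gam b) + (gam b - gam c) by ring.
move: (b - a) (c - b) (gam a - gam b) (gam b - gam c) u0 v0 => u v x y u0 v0.
rewrite ler_pdivrMr ?addr_gt0// -subr_ge0.
have -> : (x ^+ 2 / u + y ^+ 2 / v) * (u + v) - (x + y) ^+ 2 = (x * v - y * u) ^+ 2 / (u * v).
  by field; rewrite !gt_eqF.
by rewrite divr_ge0 ?sqr_ge0// mulr_ge0// ltW.
Qed.

Lemma energy_ge0 gam a s : path <=%R a s -> 0 <= energy gam a s.
Proof.
rewrite /energy; elim: s a => [|b s IH] a //= /andP[ab /IH h].
by rewrite addr_ge0// divr_ge0 ?sqr_ge0// subr_ge0.
Qed.

Lemma energy_refine gam a s1 s2 : path <=%R a s2 -> subseq s1 s2 ->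
  energy gam a s1 <= energy gam a s2.
Proof.
elim: s2 a s1 => [|b s2 IH] a [|c s1] //= pab; first by move=> _; exact: energy_ge0.
have /andP[ab pb] := pab.
case: eqP => [->|_] h; first by rewrite /energy /= lerD2l; exact: (IH b s1).
apply: (@le_trans _ _ ((gam a - gam b) ^+ 2 / (b - a) + energy gam b (c :: s1))).
  rewrite /energy /= addrA lerD2r; apply: energy_step => //.
  have := order_path_min le_trans pb; move=> /allP; apply.
  by rewrite (mem_subseq h)// mem_head.
by rewrite /energy /= lerD2l; exact: (IH b (c :: s1)).
Qed.

Lemma energy_common_refine (P : set R) a s1 s2 :
  path <=%R a s1 -> path <=%R a s2 -> {in s1, forall t, P t} -> {in s2, forall t, P t} ->
  exists s, [/\ path <=%R a s, {in s, forall t, P t} &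
    forall gam, energy gam a s1 <= energy gam a s /\ energy gam a s2 <= energy gam a s].
Proof.
move=> p1 p2 P1 P2; exists (sort <=%R (s1 ++ s2)).
have ps : path <=%R a (sort <=%R (s1 ++ s2)).
  rewrite path_sortedE; last exact: le_trans.
  rewrite (sort_sorted le_total) andbT all_sort all_cat.
  by rewrite (order_path_min le_trans p1) (order_path_min le_trans p2).
split => //.
  by move=> t; rewrite mem_sort mem_cat => /orP[/P1|/P2].
have sub t : path <=%R a t -> subseq t (s1 ++ s2) -> subseq t (sort <=%R (s1 ++ s2)).
  move=> pt ts; rewrite -[t](sorted_sort (leT := <=%R)).
  - exact: (subseq_sort le_total le_trans).
  - exact: le_trans.
  - exact: path_sorted pt.
move=> gam; split; apply: energy_refine => //; apply: sub => //.
  exact: prefix_subseq.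
exact: suffix_subseq.
Qed.

Lemma energy_parallelogram gam gam' a s :
  energy (fun t => gam t + gam' t) a s + energy (fun t => gam t - gam' t) a s =
  2 * energy gam a s + 2 * energy gam' a s.
Proof.
rewrite /energy; elim: s a => [|b s IH] a /=; first by ring.
rewrite !mulrDr addrACA IH; ring.
Qed.

Lemma energyZ c gam a s : energy (fun t => c * gam t) a s = c ^+ 2 * energy gam a s.
Proof.
rewrite /energy; elim: s a => [|b s IH] a /=; first by ring.
rewrite IH; ring.
Qed.

Lemma energy_le (T : set R) gam C a s : 0 <= C -> T a -> {in s, forall t, T t} ->
  (forall x y, T x -> T y -> x <= y -> `|gam x - gam y| <= C * (y - x)) ->
  path <=%R a s -> energy gam a s <= C ^+ 2 * (last a s - a).
Proof.
move=> C0 Ta Ts H; elim: s a Ta Ts => [|b s IH] a Ta Ts; first by rewrite subrr mulr0.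
move=> /andP[ab pb]; have Tb : T b by apply: Ts; exact: mem_head.
rewrite /energy /= -/(energy gam b s).
have := IH b Tb (fun t ts => Ts t (mem_behead (s := b :: s) ts)) pb.
suff : (gam a - gam b) ^+ 2 / (b - a) <= C ^+ 2 * (b - a) by lra.
have [e|ne] := eqVneq a b; first by rewrite e !subrr expr0n mul0r mulr0.
have ab' : 0 < b - a by rewrite subr_gt0 lt_neqAle ne.
rewrite ler_pdivrMr// -mulrA -expr2 -exprMn -(real_normK (num_real (gam a - gam b))).
rewrite ler_pXn2r// ?nnegrE ?normr_ge0 ?mulr_ge0 ?(ltW ab')//; exact: H.
Qed.

(** The inequality of arithmetic and geometric means, on each step. *)
Lemma variation_le_energy gam eta a s : 0 < eta -> path <=%R a s ->
  chain_variation gam a s <= eta * (last a s - a) + energy gam a s / eta.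
Proof.
move=> eta0; elim: s a => [|b s IH] a; first by rewrite subrr mulr0 add0r mul0r.
move=> /andP[ab pb]; rewrite /chain_variation /energy /= -/(energy gam b s) -/(chain_variation gam b s).
rewrite mulrDl; have := IH b pb.
suff : `|gam a - gam b| <= eta * (b - a) + (gam a - gam b) ^+ 2 / (b - a) / eta.
  set A := _ / eta; set B := _ / eta => h1 h2; lra.
have [e|ne] := eqVneq a b.
  by rewrite e !subrr normr0 mulr0 add0r expr0n !mul0r.
have ab' : 0 < b - a by rewrite subr_gt0 lt_neqAle ne.
rewrite -(real_normK (num_real (gam a - gam b))).
move: (b - a) ab' `|gam a - gam b| (normr_ge0 (gam a - gam b)) => u u0 x x0.
rewrite -subr_ge0.
have -> : eta * u + x ^+ 2 / u / eta - x =
    ((eta * u - x) ^+ 2 + eta * u * x) / (u * eta).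
  by field; rewrite !gt_eqF.
by rewrite divr_ge0 ?addr_ge0 ?sqr_ge0 ?mulr_ge0// ltW.
Qed.

Lemma variationB gam gam' a s :
  chain_variation gam a s <= chain_variation (fun t => gam t - gam' t) a s + chain_variation gam' a s.
Proof.
rewrite /chain_variation; elim: s a => [|b s IH] a /=; first by rewrite addr0.
have := IH b; have := ler_normD (gam a - gam' a - (gam b - gam' b)) (gam' a - gam' b).
rewrite (_ : _ + (gam' a - gam' b) = gam a - gam b); last by ring.
lra.
Qed.

Lemma variation_small gam e a s : (forall t, `|gam t| <= e) ->
  chain_variation gam a s <= (size s)%:R * (2 * e).
Proof.
move=> H; rewrite /chain_variation; elim: s a => [|b s IH] a /=; first by rewrite mul0r.
rewrite -natr1 mulrDl mul1r addrC lerD//.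
by apply: (le_trans (ler_normB _ _)); have := H a; have := H b; lra.
Qed.

End Energy.

Section Mazur.
Context {R : realType} {A : Type}.
Variables (T : set R) (l0 C : R) (z : R -> A) (r : nat -> R).
Variable K : nat -> set (A -> R).
Hypothesis T0 : T 0.
Hypothesis T_le : forall t, T t -> t <= l0.
Hypothesis C0 : 0 <= C.
Hypothesis r_decr : forall m n, (m <= n)%N -> r n <= r m.
Hypothesis r_cvg0 : forall e : R, 0 < e -> exists n, r n < e.
Hypothesis K_mid : forall n f g, K n f -> K n g -> K n (fun x => (f x + g x) / 2).
Hypothesis K_decr : forall m n, (m <= n)%N -> K n `<=` K m.
Hypothesis K_neq0 : forall n, K n !=set0.
Hypothesis K_lip : forall n f, K n f -> forall s t, T s -> T t -> s <= t ->
  `|f (z s) - f (z t)| <= C * (t - s).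
Hypothesis K_small : forall n f, K n f -> forall x, `|f x| <= 2 * r n.

Let partition s := path <=%R 0 s /\ {in s, forall t, T t}.
Let E f s := energy (fun t => f (z t)) 0 s.
Let B := C ^+ 2 * l0.

Lemma mazur_energy_le n f s : K n f -> partition s -> E f s <= B.
Proof.
move=> Kf [ps Ts]; apply: le_trans (energy_le C0 T0 Ts (K_lip Kf) ps) _.
rewrite /B ler_wpM2l ?sqr_ge0// subr0.
by case: s ps Ts => [|a s] ps Ts /=; apply: T_le => //; apply: Ts; exact: mem_last.
Qed.

Let total f := sup [set E f s | s in partition].

Lemma total_ge n f s : K n f -> partition s -> E f s <= total f.
Proof.
move=> Kf ps; apply: ub_le_sup; last by exists s.
by exists B => _ [s' ps' <-]; exact: mazur_energy_le Kf ps'.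
Qed.

Lemma total_le f b : (forall s, partition s -> E f s <= b) -> total f <= b.
Proof.
move=> H; apply: ge_sup; first by exists (E f [::]), [::] => //; split.
by move=> _ [s ps <-]; exact: H.
Qed.

(** A form of Mazur's theorem. Choose [a] in a far [K m], with almost the least
    energy that is available arbitrarily far out, and then [b] likewise but so
    much further that it is uniformly tiny. The average of [a] and [b] cannot have
    less energy, so the parallelogram law makes the energy of [a - b] small, and
    with it the variation. On a given finite partition the variation of [b] is
    small for trivial reasons; it may be chosen after the partition because the
    choice of [a] does not depend on either. *)
Lemma small_variation_exists n (e : R) : 0 < e ->
  exists2 f, K n f & forall s, partition s -> chain_variation (fun t => f (z t)) 0 s <= e.
Proof.
move=> e0; have l00 : 0 <= l0 by exact: T_le.
(* the weight in variation_le_energy: the lengths cost e / 4, the energy as much *)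
pose eta := e / (4 * (l0 + 1)).
have eta0 : 0 < eta by rewrite divr_gt0// mulr_gt0//; lra.
have etal : eta * l0 <= e / 4.
  rewrite /eta invfM mulrA -mulrA ler_piMr//; first lra.
  by rewrite mulrC ler_pdivrMr; lra.
pose del := e * eta / 64.
have del0 : 0 < del by rewrite divr_gt0// mulr_gt0.
pose low m := inf [set total f | f in K m].
have total0 m f : K m f -> 0 <= total f.
  by move=> Kf; have := total_ge Kf (s := [::]); apply; split.
have low_le m f : K m f -> low m <= total f.
  move=> Kf; apply: ge_inf; last by exists f.
  by exists 0 => _ [g Kg <-]; exact: total0 Kg.
have low_ge m b : (forall f, K m f -> b <= total f) -> b <= low m.
  move=> H; apply: lb_le_inf; first by have [f Kf] := K_neq0 m; exists (total f), f.
  by move=> _ [f Kf <-]; exact: H.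
have lowB m : low m <= B.
  have [f Kf] := K_neq0 m; apply: le_trans (low_le _ _ Kf) _.
  by apply: total_le => s; exact: mazur_energy_le Kf.
(* the least energies increase with m, and are bounded *)
pose L := sup [set low m | m in setT].
have Lub m : low m <= L.
  by apply: ub_le_sup; [exists B => _ [k _ <-]|exists m].
have Lhs : has_sup [set low m | m in setT].
  by split; [exists (low 0%N), 0%N|exists B => _ [k _ <-]].
have [_ [n1 _ <-] hn1] := sup_adherent del0 Lhs.
rewrite -/L in hn1.
have lown m : (n1 <= m)%N -> L - del <= low m.
  move=> n1m; apply: (le_trans (ltW hn1)); apply: low_ge => f /(K_decr n1m).
  exact: low_le.
have near_min m : exists2 f, K m f & total f < L + del.
  have [_ [f Kf <-] h] : exists2 x, [set total f | f in K m] x & x < low m + del.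
    apply: inf_adherent => //; split.
      by have [f Kf] := K_neq0 m; exists (total f), f.
    by exists 0 => _ [g Kg <-]; exact: total0 Kg.
  by exists f => //; have := Lub m; lra.
pose m := maxn n n1; have [a Ka ta] := near_min m.
exists a; first exact: (K_decr (leq_maxl n n1)).
move=> s ps.
have e16 : 0 < e / (8 * ((size s)%:R + 1)).
  by rewrite divr_gt0// mulr_gt0//; have := ler0n R (size s); lra.
have [k0 hk0] := r_cvg0 e16.
pose k := maxn m k0; have [b Kb tb] := near_min k.
have Kb' := K_decr (leq_maxl m k0) Kb.
have sm : chain_variation (fun t => b (z t)) 0 s <= e / 2.
  apply: le_trans (variation_small 0 s (fun t => K_small Kb (z t))) _.
  have rk : 2 * (2 * r k) <= 4 * (e / (8 * ((size s)%:R + 1))).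
    by have := r_decr (leq_maxr m k0); rewrite -/k; lra.
  apply: le_trans (ler_wpM2l (ler0n R (size s)) rk) _.
  have sz := ler0n R (size s).
  have : e / (8 * ((size s)%:R + 1)) * (8 * ((size s)%:R + 1)) = e.
    by rewrite divfK// gt_eqF// mulr_gt0//; lra.
  move: (e / _) e16 => w w0 ew; move: ew sz; move: (size s)%:R => N ew N0; lra.
have mid := K_mid Ka Kb'.
have [s2 ps2 hs2] : exists2 s2, partition s2 & L - 2 * del < E (fun x => (a x + b x) / 2) s2.
  apply: contrapT => H; suff : L - del <= L - 2 * del by lra.
  apply: (le_trans (lown m (leq_maxr _ _))); apply: (le_trans (low_le _ _ mid)).
  apply: total_le => s2 ps2; rewrite leNgt; apply/negP => h; apply: H.
  by exists s2.
have [s3 [p3 T3 h3]] := energy_common_refine ps.1 ps2.1 ps.2 ps2.2.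
have Eab : E (fun x => a x - b x) s <= 12 * del.
  have c1 := (h3 (fun t => a (z t) - b (z t))).1.
  have c2 := lt_le_trans hs2 (h3 (fun t => (a (z t) + b (z t)) / 2)).2.
  have c3 := energy_parallelogram (fun t => a (z t)) (fun t => b (z t)) 0 s3.
  have c4 := total_ge Ka (conj p3 T3); have c5 := total_ge Kb (conj p3 T3).
  move: c2; rewrite (_ : (fun t => _ / 2) = (fun t => 2^-1 * (a (z t) + b (z t)))).
    by rewrite energyZ => c2; rewrite /E in c4 c5 *; lra.
  by apply/funext => t; rewrite mulrC.
have v1 := variation_le_energy (fun t => a (z t) - b (z t)) eta0 ps.1.
have v2 := variationB (fun t => a (z t)) (fun t => b (z t)) 0 s.
have v3 : eta * (last 0 s - 0) <= eta * l0.
  rewrite subr0 ler_wpM2l ?(ltW eta0)//; apply: T_le.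
  by case: (s) ps.2 => [|c s'] Ts //=; apply: Ts; exact: mem_last.
have v4 : energy (fun t => a (z t) - b (z t)) 0 s / eta <= e / 4.
  rewrite ler_pdivrMr//; apply: (le_trans Eab); rewrite /del; nra.
lra.
Qed.

End Mazur.

(** * Pairs with cut points *)

Section CutLevels.
Context {R : realType} {M : metricType R}.
Variables p q : M.
Hypothesis pq : p != q.

Definition cut_levels : set R := [set mdist p z | z in cut_point p q].

(** The cut point at distance [t] from [p]; [p] is a junk value where there is
    none. *)
Definition cut_at (t : R) : M :=
  if pselect (exists2 z, cut_point p q z & mdist p z = t) is left e then projT1 (cid2 e) else p.

Lemma cut_at_spec t : cut_levels t -> cut_point p q (cut_at t) /\ mdist p (cut_at t) = t.
Proof.
move=> [z cz zt]; rewrite /cut_at; case: pselect => [e|[]]; last by exists z.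
by case: (cid2 e).
Qed.

Lemma cut_atE z : cut_point p q z -> cut_at (mdist p z) = z.
Proof.
move=> cz; have [|cz' e] := @cut_at_spec (mdist p z); first by exists z.
apply: mdist_positivity.
have := cut_isometry cz' cz; rewrite e => /(_ (lexx _)) ->; exact: subrr.
Qed.

Lemma cut_levels0 : cut_levels 0.
Proof. by exists p; [exact: cut_source|exact: mdistxx]. Qed.

Lemma cut_levels_target : cut_levels (mdist p q).
Proof. by exists q => //; exact: cut_target. Qed.

Lemma cut_levels_ge0 t : cut_levels t -> 0 <= t.
Proof. by move=> [z _ <-]; exact: mdist_ge0. Qed.

Lemma cut_levels_le t : cut_levels t -> t <= mdist p q.
Proof. by move=> [z /cut_dist -> <-]; rewrite lerDl mdist_ge0. Qed.

Lemma cut_at_lip (f : M -> R) C s t : lip C f ->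
  cut_levels s -> cut_levels t -> s <= t ->
  `|f (cut_at s) - f (cut_at t)| <= C * (t - s).
Proof.
move=> fC /cut_at_spec[cs es] /cut_at_spec[ct et] st.
apply: (le_trans (fC _ _)); rewrite (cut_isometry cs ct) ?es ?et//.
Qed.

End CutLevels.

Section CutPair.
Context {R : realType} {M : metricType R} (x0 : M) {F : normedModType R}.
Variable T : {linear Lip0 x0 -> dual F}.
Hypothesis T_isometry : forall f, `|T f| = `|f|.
Hypothesis T_surjective : forall phi : dual F, exists f, T f = phi.
Hypothesis Mcomplete : complete_metric M.
Context (U : set_system nat) {UU : UltraFilter U}.
Hypothesis Uoo : forall n, \forall k \near U, (n <= k)%N.

Variables (r : nat -> R) (net : nat -> seq M) (reg : nat -> set M).
Hypothesis r_gt0 : forall n, 0 < r n.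
Hypothesis r_decr : forall m n, (m <= n)%N -> r n <= r m.
Hypothesis r_cvg0 : forall e : R, 0 < e -> exists n, r n < e.
Hypothesis r_sum : forall n k, \sum_(j < k) r (n + j)%N <= 2 * r n.
Hypothesis reg_decr : forall m n, (m <= n)%N -> reg n `<=` reg m.
Hypothesis reg_net : forall n a, reg n a -> exists2 x, x \in net n & mdist a x <= 2 * r n.

Variables (g : nat -> M -> R) (h : M -> R) (C : R).
Hypothesis C0 : 0 < C.
Hypothesis gh : wlim T U g h.
Hypothesis hC : lip C h.
Hypothesis gC : forall n, lip C (g n).
Hypothesis g_supp : forall n a, g n a != 0 -> reg n a.
Hypothesis g_small : forall n a, `|g n a| <= 2 * r n.

Variables p q : M.
Hypothesis pq : p != q.
Variable n0 : nat.
Hypothesis g_var : forall n (s : seq R), (n0 <= n)%N -> path <=%R 0 s ->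
  {in s, forall t, cut_levels p q t} ->
  chain_variation (fun t => g n (cut_at p q t)) 0 s <= r n.

Let gam n1 j t := g (n1 + j)%N (cut_at p q t).
Let Theta n1 := potential (cut_levels p q) C (gam n1).

Let gam_lip n1 n s t : cut_levels p q s -> cut_levels p q t -> s <= t ->
  `|gam n1 n s - gam n1 n t| <= C * (t - s).
Proof. exact: (cut_at_lip (gC _)). Qed.

Let gam_var n1 : (n0 <= n1)%N -> forall k (s : seq R), path <=%R 0 s ->
  {in s, forall t, cut_levels p q t} ->
  \sum_(n < k) chain_cost (fun a b => `|gam n1 n a - gam n1 n b|) 0 s <= 2 * r n1.
Proof.
move=> nn k s ps Ts; apply: le_trans (r_sum n1 k); apply: ler_sum => j _.
by apply: g_var => //; rewrite (leq_trans nn)// leq_addr.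
Qed.

Let reach n1 (x : M) := [set t | t = 0 \/
  exists z, [/\ cut_point p q z, ~ conn z p x & t = Theta n1 (mdist p z)]].

(** The potential of the last cut point that separates [x] from [p], or
    0 if there is none. Beyond a cut point it ignores
    how far [x] is from it, so that it is constant on the branches. *)
Definition cut_potential n1 (x : M) : R := sup (reach n1 x).

Let Theta_mono n1 s t : cut_levels p q s -> cut_levels p q t -> s <= t ->
  Theta n1 s <= Theta n1 t.
Proof.
exact: (potential_mono (cut_levels0 pq) (@cut_levels_ge0 _ _ p q) (gam_lip n1)).
Qed.

Let Theta_step n1 s t lab : cut_levels p q s -> cut_levels p q t -> s <= t ->
  (lab = None -> gap (cut_levels p q) s t) ->
  Theta n1 t <= Theta n1 s + step_cost C (gam n1) lab s t.
Proof.
exact: (potential_step (cut_levels0 pq) (@cut_levels_ge0 _ _ p q) (gam_lip n1)).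
Qed.

Let Theta_ge0 n1 t : cut_levels p q t -> 0 <= Theta n1 t.
Proof.
exact: (potential_ge0 (cut_levels0 pq) (@cut_levels_ge0 _ _ p q) (gam_lip n1)).
Qed.

Let Theta0 n1 : Theta n1 0 <= 0.
Proof. exact: (potential0 (cut_levels0 pq) (gam_lip n1)). Qed.

Let cut_level z : cut_point p q z -> cut_levels p q (mdist p z).
Proof. by move=> cz; exists z. Qed.

Let reach_ub n1 x : has_ubound (reach n1 x).
Proof.
exists (Theta n1 (mdist p q)) => _ [->|[z [cz _ ->]]].
  by apply: Theta_ge0; apply: cut_level; exact: cut_target.
apply: Theta_mono; [exact: cut_level|apply: cut_level; exact: cut_target|].
by apply: (@cut_levels_le _ _ p q); exact: cut_level.
Qed.

Lemma cut_potential_ge n1 x z : cut_point p q z -> ~ conn z p x ->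
  Theta n1 (mdist p z) <= cut_potential n1 x.
Proof. by move=> cz zx; apply: (ub_le_sup (reach_ub n1 x)); right; exists z. Qed.

Lemma cut_potential_ge0 n1 x : 0 <= cut_potential n1 x.
Proof. by apply: (ub_le_sup (reach_ub n1 x)); left. Qed.

Lemma cut_potential_le n1 x b : 0 <= b ->
  (forall z, cut_point p q z -> ~ conn z p x -> Theta n1 (mdist p z) <= b) ->
  cut_potential n1 x <= b.
Proof.
move=> b0 H; apply: ge_sup; first by exists 0; left.
by move=> _ [->//|[z [cz zx ->]]]; exact: H.
Qed.

Lemma cut_potentialE n1 z : cut_point p q z -> cut_potential n1 z = Theta n1 (mdist p z).
Proof.
move=> cz; apply/eqP; rewrite eq_le; apply/andP; split.
  apply: cut_potential_le; first exact/Theta_ge0/cut_level.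
  move=> w cw wz; apply: Theta_mono; [exact: cut_level|exact: cut_level|].
  by rewrite leNgt; apply/negP => /(cut_before cz cw).
have [e|ne] := eqVneq p z; last first.
  by apply: cut_potential_ge => // /not_conn_self e; rewrite e eqxx in ne.
by rewrite -e mdistxx; apply: (le_trans (Theta0 n1)); exact: cut_potential_ge0.
Qed.

(** The supremum of the levels passed by [x] is attained, cut points being
    closed. *)
Lemma last_level n1 x : exists s, [/\ cut_levels p q s, Theta n1 s <= cut_potential n1 x,
  (forall w, cut_point p q w -> s < mdist p w -> conn w p x) &
  (forall b, 0 <= b -> (forall w, cut_point p q w -> ~ conn w p x -> mdist p w <= b) -> s <= b)].
Proof.
pose B := [set t | t = 0 \/ exists z, [/\ cut_point p q z, ~ conn z p x & t = mdist p z]].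
have Bub : has_ubound B.
  exists (mdist p q) => _ [->|[z [cz _ ->]]]; first exact: mdist_ge0.
  by apply: (@cut_levels_le _ _ p q); exact: cut_level.
have B0 : B 0 by left.
have s0 : 0 <= sup B by exact: ub_le_sup.
exists (sup B).
have after w : cut_point p q w -> sup B < mdist p w -> conn w p x.
  move=> cw sw; apply: contrapT => wx.
  have : mdist p w <= sup B by apply: ub_le_sup => //; right; exists w.
  by rewrite leNgt sw.
have below b : 0 <= b ->
    (forall w, cut_point p q w -> ~ conn w p x -> mdist p w <= b) -> sup B <= b.
  move=> b0 H; apply: ge_sup; first by exists 0.
  by move=> _ [->//|[z [cz zx ->]]]; exact: H.
move: s0; rewrite le_eqVlt => /predU1P[s0|s0].
  split=> //; rewrite -s0; first exact: cut_levels0.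
  by apply: (le_trans (Theta0 n1)); exact: cut_potential_ge0.
(* closer to sup B than sup B is to 0, so not the value 0 adjoined to B *)
have [|w [cw wx ew]] := @cut_closed _ _ p q Mcomplete x (sup B).
  move=> e e0; have m0 : 0 < Num.min e (sup B) by rewrite lt_min e0.
  have [b Bb hb] := sup_adherent m0 (conj (ex_intro _ 0 B0) Bub).
  have b0 : 0 < b.
    apply: le_lt_trans hb; rewrite subr_ge0 ge_min lexx orbT//.
  have bs : b <= sup B by exact: ub_le_sup.
  case: Bb => [b00|[z [cz zx bz]]]; first by rewrite b00 ltxx in b0.
  exists z; split => //; rewrite -bz distrC ger0_norm ?subr_ge0//.
  have : Num.min e (sup B) <= e by rewrite ge_min lexx.
  lra.
by split => //; rewrite -ew; [exact: cut_level|exact: cut_potential_ge].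
Qed.

(** Consider the infimum of the levels above [s]. If it is [s] itself, then there
    are levels so close that even the full slope costs less than [e]; if not, it
    is the other end of a gap, which is crossed for free. *)
Lemma next_level n1 s t (e : R) : cut_levels p q s -> cut_levels p q t -> s < t -> 0 < e ->
  exists w, [/\ cut_point p q w, s < mdist p w, mdist p w <= t & Theta n1 (mdist p w) <= Theta n1 s + e].
Proof.
move=> Ts Tt st e0.
pose B := [set u | cut_levels p q u /\ s < u].
have Blb : has_lbound B by exists s => u [_ /ltW].
have Bt : B t by [].
have infs : s <= inf B by apply: lb_le_inf; [exists t|move=> u [_ /ltW]].
have inft : inf B <= t by exact: ge_inf.
have Binf : has_inf B by split => //; exists t.
have C00 : 0 < C by exact: C0.
move: infs; rewrite le_eqVlt => /predU1P[es|sinf].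
  have m0 : 0 < Num.min (t - s) (e / C) by rewrite lt_min subr_gt0 st divr_gt0.
  have [b [Tb sb] hb] := inf_adherent m0 Binf.
  rewrite -es in hb.
  have h1 : Num.min (t - s) (e / C) <= t - s by rewrite ge_min lexx.
  have h2 : Num.min (t - s) (e / C) <= e / C by rewrite ge_min lexx orbT.
  have [cw ew] := cut_at_spec Tb.
  exists (cut_at p q b); rewrite ew; split => //; first lra.
  apply: (le_trans (@Theta_step n1 s b (Some 0%N) Ts Tb (ltW sb) _)) => //=.
  rewrite lerD2l lerBlDr (le_trans (_ : _ <= e))//; last by rewrite lerDl.
  have : b - s <= e / C by lra.
  by rewrite ler_pdivlMr// mulrC.
have [|w [cw _ ew]] := @cut_closed _ _ p q Mcomplete q (inf B).
  move=> d d0; have [b [[w cw wb] sb] hb] := inf_adherent d0 Binf.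
  have : inf B <= b by apply: ge_inf => //; split => //; exists w.
  move=> bb; exists w; split => //; rewrite wb ger0_norm ?subr_ge0//; lra.
exists w; rewrite ew; split => //.
have gp : gap (cut_levels p q) s (inf B).
  split => // u Tu /andP[su]; rewrite ltNge => /negP; apply.
  by apply: ge_inf.
have Ti : cut_levels p q (inf B) by exists w.
have := @Theta_step n1 s (inf B) None Ts Ti (ltW sinf) (fun _ => gp).
rewrite /= addr0 => h1; apply: (le_trans h1); rewrite lerDl; exact: ltW.
Qed.

(** If [y] lies beyond a cut point [z] that [x] has not passed, then the way from
    [x] to [y] goes through a cut point [w] which is passed right after [x], and
    through [z]. The potential increases between [w] and [z] by at most the room
    that [g (n1 + j)] leaves there, and not by more than [e] before [w]. *)
Lemma cut_potential_test n1 j x y :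
  `|g (n1 + j)%N x - g (n1 + j)%N y| + (cut_potential n1 y - cut_potential n1 x)
  <= C * mdist x y.
Proof.
set gn := g (n1 + j)%N; have gnC : lip C gn by exact: gC.
have Gx0 := cut_potential_ge0 n1 x; have gxy := gnC x y.
suff : cut_potential n1 y <= cut_potential n1 x + C * mdist x y - `|gn x - gn y| by lra.
apply: cut_potential_le; first lra.
move=> z cz zy; have [zx|zx] := pselect (conn z p x); last first.
  by have := cut_potential_ge n1 cz zx; lra.
have [s [Ts Gs after below]] := last_level n1 x.
have st : s <= mdist p z.
  apply: below; first exact: mdist_ge0.
  move=> w cw wx; rewrite leNgt; apply/negP => zw; apply: wx.
  exact: conn_mono cz cw zw zx.
apply/ler_addgt0Pr => /= e e0.
have Tz := cut_level cz.
move: st; rewrite le_eqVlt => /predU1P[<-|st]; first by lra.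
have [w [cw sw wt hw]] := next_level n1 Ts Tz st e0.
have wx := after w cw sw.
have wy : ~ conn w p y.
  move: wt; rewrite le_eqVlt => /predU1P[ewz|wz].
    by rewrite -(cut_atE cw) ewz (cut_atE cz).
  by move=> /(conn_mono cw cz wz).
have dxy := cut_between wx wy.
have dwz := cut_isometry cw cz wt.
have dwy : mdist w y = mdist w z + mdist z y.
  move: wt; rewrite le_eqVlt => /predU1P[ewz|wz].
    by rewrite -(cut_atE cw) ewz (cut_atE cz) mdistxx add0r.
  exact: (cut_between (cut_before cw cz wz) zy).
have := @Theta_step n1 _ _ (Some j) (cut_level cw) Tz wt (fun e => ltac:(discriminate e)).
rewrite /= /gam (cut_atE cw) (cut_atE cz) -/gn -dwz => h1.
have h2 := gnC x w; have h3 := gnC z y.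
have h4 := ler_distD (gn w) (gn x) (gn y); have h5 := ler_distD (gn z) (gn w) (gn y).
rewrite dxy dwy; lra.
Qed.

(** By [cut_potential_test], restricted to cut points the limit [h] is one of the
    functions [eta] of [potential_rigid]; across gaps it is constant by
    [wlim_no_cut_point]. The bound [2 * r n1] for the total variation tends to 0,
    because the functions before the [n1]-th may be left out. *)
Lemma wlim_cut_pair : h p = h q.
Proof.
apply/eqP; rewrite -subr_eq0 -normr_le0; apply/ler_addgt0Pr => /= e e0; rewrite add0r.
have [n2 hn2] := r_cvg0 (divr_gt0 e0 (ltr0n R 2)).
pose n1 := maxn n0 n2.
have r1 : 2 * r n1 <= e by have := r_decr (leq_maxr n0 n2); rewrite -/n1; lra.
apply: le_trans r1.
have C00 : 0 <= C by exact: ltW.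
have test : \forall n \near U, forall x y,
    `|g n x - g n y| + (cut_potential n1 y - cut_potential n1 x) <= C * mdist x y.
  apply: filterS (Uoo n1) => n /subnKC <- x y; exact: cut_potential_test.
have gC' : \forall n \near U, lip C (g n) by exact: nearW.
have h1 x y : h x - h y + (cut_potential n1 x - cut_potential n1 y) <= C * mdist x y.
  refine (wlim_ball T_isometry _ gh C00 hC gC' _ x y).
  apply: filterS test => n H a b; have := H b a; rewrite metric_sym distrC.
  by have := ler_norm (g n a - g n b); lra.
have h2 x y : h x - h y + (- cut_potential n1 x - - cut_potential n1 y) <= C * mdist x y.
  refine (wlim_ball T_isometry _ gh C00 hC gC' (G := fun x => - cut_potential n1 x) _ x y).
  apply: filterS test => n H a b; have := H a b.
  by have := ler_norm (g n a - g n b); lra.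
have -> : p = cut_at p q 0 by rewrite -[in RHS](mdistxx p) cut_atE//; exact: cut_source.
have -> : h q = h (cut_at p q (mdist p q)) by rewrite cut_atE//; exact: cut_target.
have pE : cut_at p q 0 = p by rewrite -[in LHS](mdistxx p) cut_atE//; exact: cut_source.
rewrite pE.
have := @potential_rigid _ (cut_levels p q) (mdist p q) C (2 * r n1) (gam n1)
  (cut_levels0 pq) (@cut_levels_ge0 _ _ p q) (cut_levels_target pq) (gam_lip n1).
have n01 : (n0 <= n1)%N by exact: leq_maxl.
move=> /(_ (gam_var n01) (fun t => h (cut_at p q t))); rewrite pE; apply.
  move=> s t Ts Tt st; have [cs es] := cut_at_spec Ts; have [ct et] := cut_at_spec Tt.
  have := h1 (cut_at p q t) (cut_at p q s); have := h2 (cut_at p q s) (cut_at p q t).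
  rewrite !cut_potentialE// es et (metric_sym (cut_at p q t)) (cut_isometry cs ct) ?es ?et//.
  rewrite -/(Theta n1) => a1 a2; rewrite ler_norml; apply/andP; split; lra.
move=> s t Ts Tt [st gp]; have [cs es] := cut_at_spec Ts; have [ct et] := cut_at_spec Tt.
apply: (wlim_no_cut_point T_isometry T_surjective Mcomplete Uoo r_gt0 r_decr r_cvg0
  reg_decr reg_net C0 gh hC gC g_supp g_small).
apply: (gap_no_cut cs ct); rewrite es et// => w cw.
by apply: gp; exact: cut_level.
Qed.

End CutPair.

(** * Localizing an action that finite sets do not control *)

Section FiniteSetUltrafilter.
Context {A : eqType}.

Definition finite_subsets_filter : set_system (seq A) :=
  [set P : set (seq A) | exists S0 : seq A, forall S : seq A, {subset S0 <= S} -> P S].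

Lemma finite_subsets_proper : ProperFilter finite_subsets_filter.
Proof.
split; first by move=> [S0 /(_ S0)]; apply.
split.
- by exists [::].
- move=> P Q [S1 h1] [S2 h2]; exists (S1 ++ S2) => S sub; split.
    by apply: h1 => x xS; apply: sub; rewrite mem_cat xS.
  by apply: h2 => x xS; apply: sub; rewrite mem_cat xS orbT.
- by move=> P Q PQ [S0 h]; exists S0 => S /h /PQ.
Qed.

Lemma finite_subsets_ultra : exists U : set_system (seq A),
  UltraFilter U /\ forall x, \forall S \near U, x \in S.
Proof.
have [U [UU sub]] := @ultraFilterLemma _ _ finite_subsets_proper.
exists U; split => // x; apply: sub; exists [:: x] => S; apply.
exact: mem_head.
Qed.

End FiniteSetUltrafilter.

Section FiniteCutoffs.
Context {R : realType} {M : metricType R}.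

Fixpoint tents (S : seq M) (r : R) (a : M) : R :=
  if S is s :: S' then Num.max (tent s r a) (tents S' r a) else 0.

Lemma tents_ge0 S r a : 0 <= tents S r a.
Proof. by case: S => //= s S; rewrite le_max tent_ge0. Qed.

Lemma tents_le1 S r a : tents S r a <= 1.
Proof. by elim: S => //= s S IH; rewrite ge_max tent_le1. Qed.

Lemma tents_eq1 S r a s : 0 < r -> s \in S -> mdist s a <= r -> tents S r a = 1.
Proof.
move=> r0 + sa; elim: S => //= t S IH; rewrite inE => /orP[/eqP<-|/IH ->].
  by rewrite tent_eq1 ?(max_idPl _) ?tents_le1// metric_sym.
by rewrite (max_idPr _)// tent_le1.
Qed.

Lemma tents_support S r a : 0 < r -> tents S r a != 0 ->
  exists2 s, s \in S & mdist a s <= 2 * r.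
Proof.
move=> r0; elim: S => [|s S IH] /=; first by rewrite eqxx.
have [e|ne] := eqVneq (tents S r a) 0.
  rewrite e (max_idPl (tent_ge0 _ _ _)) => /tent_support h.
  by exists s; [exact: mem_head|exact: h].
by move=> _; have [t tS ta] := IH ne; exists t => //; rewrite inE tS orbT.
Qed.

Lemma lip_tents S r : 0 < r -> lip r^-1 (tents S r).
Proof.
move=> r0; elim: S => [|s S IH] /=; first by apply: lip_cst; rewrite invr_ge0 ltW.
by apply: lip_max => //; exact: lip_tent.
Qed.

End FiniteCutoffs.

Section Tail.
Context {R : realType} {M : metricType R} (x0 : M) {F : normedModType R}.
Variable T : {linear Lip0 x0 -> dual F}.
Hypothesis T_isometry : forall f, `|T f| = `|f|.
Hypothesis T_surjective : forall phi : dual F, exists f, T f = phi.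
Variable y : F.

Lemma action_cst f : (forall x x', f x = f x') -> action T y f = 0.
Proof.
move=> H; apply/eqP; rewrite -normr_le0 -(mul0r `|y|).
apply: (action_bound T_isometry) => // a b.
by rewrite (H a b) subrr normr0 mul0r.
Qed.

Lemma actionD k l f g : lip k f -> lip l g ->
  action T y (fun x => f x + g x) = action T y f + action T y g.
Proof.
move=> fk gl; rewrite -[action T y f]mul1r -(action_linear T y 1 fk gl).
by congr (action T y _); apply/funext => x; rewrite mul1r.
Qed.

(** The lower bound of the actions would pass to the limit, which is constant and
    has no action. *)
Lemma no_escaping_family (v : seq M -> M -> R) (C r eta : R) : 0 < C -> 0 < r ->
  (forall S, lip C (v S)) ->
  (forall (S : seq M) s x, s \in S -> mdist s x <= r -> v S x = 0) ->
  0 < eta -> ~ (forall S, eta <= action T y (v S)).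
Proof.
move=> C0 r0 vC v0 eta0 H; have [U [UU Ufin]] := @finite_subsets_ultra M.
have vC' : \forall S \near U, lip C (v S) by exact: nearW.
have [h [hC _ vh]] := wlim_exists T_isometry T_surjective UU (ltW C0) vC'.
have v0' : \forall S \near U, forall s x, s \in S -> mdist s x <= r -> v S x = 0.
  exact: nearW.
have hcst : forall x x', h x = h x'.
  exact: (wlim_vanishing_near_points T_isometry Ufin C0 r0 vh hC vC' v0').
have : eta <= action T y h by apply: (cvgr_to_ge (vh y)); exact: nearW.
by rewrite (action_cst hcst) leNgt eta0.
Qed.

(** The action of [y] on the part of a function seen through [W] is not controlled
    by any finite set. *)
Definition escapes (W : M -> R) (b c : R) := forall S : seq M,
  exists f, [/\ lip 1 f, forall x, `|f x| <= b, {in S, forall s, f s = 0} &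
    c <= action T y (fun x => W x * f x)].

Lemma finite_bounded (S : seq M) : exists b : R, 0 <= b /\ {in S, forall s, mdist s x0 <= b}.
Proof.
elim: S => [|s S [b [b0 hb]]]; first by exists 0.
exists (b + mdist s x0); split; first by rewrite addr_ge0 ?mdist_ge0.
move=> t; rewrite inE => /orP[/eqP ->|/hb h]; first by rewrite lerDr.
by rewrite (le_trans h)// lerDl mdist_ge0.
Qed.

Definition clip (b : R) (f : M -> R) (x : M) := Num.max (- b) (Num.min b (f x)).

Lemma lip_clip k b f : 0 <= k -> lip k f -> lip k (clip b f).
Proof.
by move=> k0 fk; apply: lip_max; [exact: lip_cst|apply: lip_min => //; exact: lip_cst].
Qed.

Lemma clip_le b f x : 0 <= b -> `|clip b f x| <= b.
Proof.
move=> b0; rewrite ler_norml /clip le_max lexx/= ge_max ge_min lexx/= andbT; lra.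
Qed.

Lemma clip_id b f x : `|f x| <= b -> clip b f x = f x.
Proof.
by rewrite ler_norml /clip => /andP[h1 h2]; rewrite (min_idPr h2) (max_idPr h1).
Qed.

(** Far from the points of a finite set a function has to be clipped, but not near
    them, since its values there are bounded by their distance to [x0]. So the
    parts that clipping removes form an escaping family. *)
Lemma bounded_escape (c : R) : 0 < c ->
  (forall S : seq M, exists f, [/\ lip 1 f, {in S, forall s, f s = 0} & c <= action T y f]) ->
  exists2 b : R, 0 <= b & escapes (fun=> 1) b (c / 2).
Proof.
move=> c0 H; apply: contrapT => Hn.
have /choice[S1 hS1] (b : R) : exists S : seq M, 0 <= b -> forall f, lip 1 f ->
    (forall x, `|f x| <= b) -> {in S, forall s, f s = 0} -> action T y f < c / 2.
  have [b0|] := pselect (0 <= b); last by exists [::].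
  apply: contrapT => Hb; apply: Hn; exists b => // S.
  apply: contrapT => HS; apply: Hb; exists S => _ f f1 fb fS.
  rewrite ltNge; apply/negP => hc; apply: HS; exists f; split => //.
  by rewrite (_ : (fun x => _) = f)//; apply/funext => x; rewrite mul1r.
have /choice[b hb] := finite_bounded.
have /choice[f hf] (S : seq M) : exists f, [/\ lip 1 f, {in x0 :: S1 (b S + 1), forall s, f s = 0} &
    c <= action T y f] by exact: H.
pose v S x := f S x - clip (b S + 1) (f S) x.
have b1 S : 0 <= b S + 1 by have [] := hb S; lra.
have vC S : lip 2 (v S).
  have [f1 _ _] := hf S; have -> : 2 = 1 + 1 :> R by ring.
  by apply: lipB => //; exact: lip_clip.
have c2 : 0 < c / 2 by lra.
apply: (@no_escaping_family v 2 1 (c / 2)) => //.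
- move=> S s x sS sx; have [f1 f0 _] := hf S; have [_ hbS] := hb S.
  rewrite /v clip_id ?subrr//.
  have := f1 x x0; rewrite (f0 x0 (mem_head _ _)) subr0 mul1r => /le_trans; apply.
  have := metric_triangle x s x0; have := hbS s sS; rewrite (metric_sym x s); lra.
- move=> S; have [f1 f0 fc] := hf S.
  have cl1 : lip 1 (clip (b S + 1) (f S)) by exact: lip_clip.
  have cl0 : {in S1 (b S + 1), forall s, clip (b S + 1) (f S) s = 0}.
    by move=> s sS; rewrite clip_id f0 ?normr0// inE sS orbT.
  have h1 := hS1 (b S + 1) (b1 S) _ cl1 (fun x => clip_le (f S) x (b1 S)) cl0.
  have := @actionD _ _ _ _ (vC S) cl1.
  rewrite (_ : (fun x => _) = f S); first by lra.
  by apply/funext => x; rewrite /v subrK.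
Qed.
End Tail.

Section Radius.
Context {R : realType}.

Definition radius (n : nat) : R := 2^-1 ^+ n.

Lemma radius_gt0 n : 0 < radius n.
Proof. by rewrite /radius exprn_gt0// invr_gt0. Qed.

Lemma radius_decr m n : (m <= n)%N -> radius n <= radius m.
Proof.
by move=> mn; rewrite /radius; apply: ler_wiXn2l => //; rewrite ?invr_ge0// invf_le1// ler1n.
Qed.

Lemma radius_cvg0 (e : R) : 0 < e -> exists n, radius n < e.
Proof.
move=> e0; exists (Num.bound e^-1); rewrite /radius exprVn invf_plt ?posrE ?exprn_gt0//.
apply: lt_trans (archi_boundP _) _; first by rewrite invr_ge0 ltW.
by rewrite -natrX ltr_nat; exact: ltn_expl.
Qed.

Lemma radius_sum n k : \sum_(j < k) radius (n + j)%N <= 2 * radius n.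
Proof.
suff : \sum_(j < k) radius (n + j)%N <= 2 * radius n - 2 * radius (n + k)%N.
  by have := radius_gt0 (n + k); lra.
elim: k => [|k IH]; first by rewrite big_ord0 addn0 subrr.
rewrite big_ord_recr /= addnS.
have -> : radius (n + k).+1 = radius (n + k)%N / 2 by rewrite /radius exprS mulrC.
lra.
Qed.

End Radius.

Section Localization.
Context {R : realType} {M : metricType R} (x0 : M) {F : normedModType R}.
Variable T : {linear Lip0 x0 -> dual F}.
Hypothesis T_isometry : forall f, `|T f| = `|f|.
Hypothesis T_surjective : forall phi : dual F, exists f, T f = phi.
Variable y : F.

(** If the cutoff near every finite [S] destroyed the action, then the parts cut
    away, which vanish near [S], would be an escaping family. *)
Lemma escape_step (W : M -> R) (l b c r eta : R) : 0 <= l -> 0 <= b -> 0 < r -> 0 < eta ->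
  lip l W -> (forall x, 0 <= W x <= 1) -> escapes T y W b c ->
  exists S : seq M, escapes T y (fun x => W x * tents S r x) b (c - eta).
Proof.
move=> l0 b0 r0 eta0 Wl W01 esc; apply: contrapT => Hn.
have ri0 : 0 <= r^-1 by rewrite invr_ge0 ltW.
have /choice[S1 hS1] (S : seq M) : exists S1 : seq M, forall f, lip 1 f ->
    (forall x, `|f x| <= b) -> {in S1, forall s, f s = 0} ->
    action T y (fun x => W x * tents S r x * f x) < c - eta.
  apply: contrapT => HS; apply: Hn; exists S => S1.
  apply: contrapT => HS1; apply: HS; exists S1 => f f1 fb fS.
  by rewrite ltNge; apply/negP => hc; apply: HS1; exists f.
have /choice[f hf] (S : seq M) := esc (S1 S).
pose v S x := W x * (1 - tents S r x) * f S x.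
have W1 x : `|W x| <= 1 by have /andP[? ?] := W01 x; rewrite ger0_norm.
have t1 (S : seq M) x : `|1 - tents S r x| <= 1.
  by have := tents_ge0 S r x; have := tents_le1 S r x; rewrite ler_norml; lra.
have t2 (S : seq M) x : `|tents S r x| <= 1 by rewrite ger0_norm ?tents_ge0// tents_le1.
have tlip (S : seq M) : lip r^-1 (fun x => 1 - tents S r x).
  rewrite -[r^-1]add0r; apply: lipB; first by apply: lip_cst.
  exact: lip_tents.
have prod (w : M -> R) S : lip r^-1 w -> (forall x, `|w x| <= 1) ->
    lip (1 + b * (r^-1 + l)) (fun x => W x * w x * f S x).
  move=> wl w1; have [f1 fb _ _] := hf S.
  have h1 : lip (r^-1 + 1 * l) (fun x => W x * w x).
    by apply: lip_mul => // x _; exact: w1.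
  rewrite mul1r in h1; apply: lip_mul => //; first by rewrite addr_ge0.
  by move=> x; rewrite normrM -[leRHS]mul1r ler_pM.
have C0 : 0 < 1 + b * (r^-1 + l).
  by rewrite ltr_wpDr// mulr_ge0// addr_ge0.
apply: (@no_escaping_family _ _ _ _ T T_isometry T_surjective y v _ r eta C0 r0 _ _ eta0).
- by move=> S; exact: prod.
- by move=> S s x sS sx; rewrite /v (tents_eq1 r0 sS sx) subrr mulr0 mul0r.
move=> S; have [f1 fb fS fc] := hf S.
have h1 := hS1 S (f S) f1 fb fS.
have := actionD T y (prod _ S (tlip S) (t1 S)) (prod _ S (lip_tents S r0) (t2 S)).
rewrite (_ : (fun x => _) = (fun x => W x * f S x)); last by apply/funext => x; ring.
by rewrite -/(v S); lra.
Qed.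

Variable c : R.
Hypothesis c0 : 0 < c.

(** The [n]-th cutoff loses at most [c / 2 * radius n.+1] of the action, and
    these losses add up to at most [c / 2]. *)
Lemma cutoff_sequence (b : R) : 0 <= b -> escapes T y (fun=> 1) b c ->
  exists (W : nat -> M -> R) (net : nat -> seq M),
  [/\ forall n x, W n.+1 x = W n x * tents (net n) (radius n) x,
      forall n x, 0 <= W n x <= 1,
      forall n, lip (2 ^+ n) (W n) &
      forall n, escapes T y (W n) b (c / 2)].
Proof.
move=> b0 esc.
pose good n (W : M -> R) := [/\ forall x, 0 <= W x <= 1, lip (2 ^+ n) W &
  escapes T y W b (c / 2 + c / 2 * radius n)].
have step n W : exists S : seq M, good n W -> good n.+1 (fun x => W x * tents S (radius n) x).
  have [[W01 Wl We]|] := pselect (good n W); last by exists [::].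
  have l0 : 0 <= 2 ^+ n :> R by exact: exprn_ge0.
  have eta0 : 0 < c / 2 * radius n.+1 by rewrite mulr_gt0 ?radius_gt0// divr_gt0.
  have [S hS] := escape_step l0 b0 (radius_gt0 n) eta0 Wl W01 We.
  exists S => _; split.
  - move=> x; have /andP[h1 h2] := W01 x; rewrite mulr_ge0 ?tents_ge0//=.
    by rewrite -[leRHS]mul1r ler_pM ?tents_ge0 ?tents_le1.
  - have -> : (2 : R) ^+ n.+1 = (radius n)^-1 + 1 * 2 ^+ n.
      by rewrite /radius exprVn invrK exprS mul1r; ring.
    apply: lip_mul => //; first by rewrite invr_ge0 (ltW (radius_gt0 n)).
    + by move=> x; have /andP[? ?] := W01 x; rewrite ger0_norm.
    + exact/lip_tents/radius_gt0.
    + by move=> x _; rewrite ger0_norm ?tents_ge0// tents_le1.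
  - suff <- : c / 2 + c / 2 * radius n - c / 2 * radius n.+1 = c / 2 + c / 2 * radius n.+1 by [].
    by rewrite /radius exprS; field.
have /choice[sig hsig] (nW : nat * (M -> R)) : exists S : seq M,
    good nW.1 nW.2 -> good nW.1.+1 (fun x => nW.2 x * tents S (radius nW.1) x).
  by case: nW => n W; exact: step.
pose Wn := fix Wn n : M -> R := if n is m.+1
  then fun x => Wn m x * tents (sig (m, Wn m)) (radius m) x else fun=> 1.
have gn n : good n (Wn n).
  elim: n => [|n IH]; last exact: (hsig (n, Wn n)).
  split; first by move=> x; rewrite ler01 lexx.
    by apply: lip_cst; rewrite expr0.
  suff -> : c / 2 + c / 2 * radius 0%N = c by [].
  by rewrite /radius expr0; field.
exists Wn, (fun n => sig (n, Wn n)); split => //.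
- by move=> n; have [] := gn n.
- by move=> n; have [] := gn n.
move=> n; have [_ _ h] := gn n => S; have [f [f1 f2 f3 f4]] := h S.
exists f; split => //; apply: le_trans f4; rewrite lerDl mulr_ge0 ?(ltW (radius_gt0 n))//.
by rewrite divr_ge0// ltW.
Qed.

End Localization.

(** * Control of an action by a finite set *)

Section Selection.
Context {R : realType} {M : metricType R}.
Variables (C : R) (r : nat -> R).
Hypothesis C0 : 0 <= C.
Hypothesis r_decr : forall m n, (m <= n)%N -> r n <= r m.
Hypothesis r_cvg0 : forall e : R, 0 < e -> exists n, r n < e.

Lemma variation_mid (f g : R -> R) (e : R) a s :
  chain_variation f a s <= e -> chain_variation g a s <= e ->
  chain_variation (fun t => (f t + g t) / 2) a s <= e.
Proof.
move=> fe ge; suff : chain_variation (fun t => (f t + g t) / 2) a s <=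
    (chain_variation f a s + chain_variation g a s) / 2 by lra.
rewrite /chain_variation; elim: s a {fe ge} => [|b s IH] a /=; first by rewrite addr0 mul0r.
have := IH b.
have : `|(f a + g a) / 2 - (f b + g b) / 2| <= (`|f a - f b| + `|g a - g b|) / 2.
  rewrite (_ : _ - _ = ((f a - f b) + (g a - g b)) / 2); last by ring.
  rewrite normrM (@ger0_norm _ 2^-1) ?invr_ge0// ler_wpM2r ?invr_ge0//.
  exact: ler_normD.
lra.
Qed.

(** Small variation along the cut points of one pair is a convex condition, so it
    may be added to the requirements defining [K] before the next pair is
    treated. *)
Lemma small_variation_pairs (l : seq (M * M)) (K : nat -> set (M -> R)) :
  (forall n f g, K n f -> K n g -> K n (fun x => (f x + g x) / 2)) ->
  (forall m n, (m <= n)%N -> K n `<=` K m) ->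
  (forall n, K n !=set0) ->
  (forall n f, K n f -> lip C f) ->
  (forall n f, K n f -> forall x, `|f x| <= 2 * r n) ->
  forall n (e : R), 0 < e -> exists2 f, K n f &
    forall p q, (p, q) \in l -> p != q -> forall s : seq R, path <=%R 0 s ->
      {in s, forall t, cut_levels p q t} ->
      chain_variation (fun t => f (cut_at p q t)) 0 s <= e.
Proof.
elim: l K => [|[p q] l IH] K Kmid Kdecr K0 Klip Ksmall n e e0.
  by have [f Kf] := K0 n; exists f.
have [<-|pq] := eqVneq p q.
  have [f Kf Hf] := IH K Kmid Kdecr K0 Klip Ksmall n e e0.
  exists f => // p' q'; rewrite inE => /orP[/eqP[-> ->]|]; first by rewrite eqxx.
  exact: Hf.
pose K' n := [set f | K n f /\ forall s : seq R, path <=%R 0 s ->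
  {in s, forall t, cut_levels p q t} ->
  chain_variation (fun t => f (cut_at p q t)) 0 s <= e].
have [|||||f [Kf fe] Hf] := IH K' _ _ _ _ _ n e e0.
- move=> m f g [Kf fe] [Kg ge]; split; first exact: Kmid.
  move=> s ps Ts; exact: (variation_mid (fe s ps Ts) (ge s ps Ts)).
- by move=> m k mk f [Kf fe]; split => //; exact: Kdecr Kf.
- move=> m.
  have [||f Kf Hf] := @small_variation_exists R M (cut_levels p q) (mdist p q) C (cut_at p q) r K
    (cut_levels0 pq) _ C0 r_decr r_cvg0 Kmid Kdecr K0 _ Ksmall m e e0.
  + by move=> t; exact: cut_levels_le.
  + by move=> m' f Kf s t; apply: cut_at_lip; exact: Klip Kf.
  by exists f; split => // s ps Ts; apply: Hf.
- by move=> m f [/Klip].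
- by move=> m f [/Ksmall].
exists f => // p' q'; rewrite inE => /orP[/eqP[-> ->] _ s|]; first exact: fe.
exact: Hf.
Qed.

End Selection.

Section Core.
Context {R : realType} {M : metricType R} (x0 : M) {F : normedModType R}.
Variable T : {linear Lip0 x0 -> dual F}.
Hypothesis T_isometry : forall f, `|T f| = `|f|.

Context (U : set_system nat) {UU : UltraFilter U}.
Hypothesis Uoo : forall n, \forall k \near U, (n <= k)%N.

Variables (r : nat -> R) (net : nat -> seq M) (reg : nat -> set M).
Hypothesis r_gt0 : forall n, 0 < r n.
Hypothesis r_decr : forall m n, (m <= n)%N -> r n <= r m.
Hypothesis r_cvg0 : forall e : R, 0 < e -> exists n, r n < e.
Hypothesis reg_decr : forall m n, (m <= n)%N -> reg n `<=` reg m.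
Hypothesis reg_net : forall n a, reg n a -> exists2 x, x \in net n & mdist a x <= 2 * r n.

Variables (g : nat -> M -> R) (h : M -> R) (C : R).
Hypothesis C0 : 0 < C.
Hypothesis gh : wlim T U g h.
Hypothesis hC : lip C h.
Hypothesis gC : forall n, lip C (g n).
Hypothesis g_supp : forall n a, g n a != 0 -> reg n a.
Hypothesis g_small : forall n a, `|g n a| <= 2 * r n.
Hypothesis h_net : exists c, forall n x, x \in net n -> h x = c.

(** Let [psi] be [h - c] with the values between [- b] and [b] collapsed to 0,
    where [b] is a multiple of [r m]. Near the net of index [m] the values of
    [h] are within [b] of [c], so that [psi] is 0; away from it [g n]
    eventually vanishes and [h] is locally constant by [wlim_local]. Hence
    [psi] is constant at the scale [r m / 2], and constant by
    [scale_induction]. *)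
Lemma wlim_constant : forall x x', h x = h x'.
Proof.
have [c hc] := h_net => x x'.
suff H m : `|h x - h x'| <= 8 * C * r m.
  apply/eqP; rewrite -subr_eq0 -normr_le0; apply/ler_addgt0Pr => /= e e0; rewrite add0r.
  have C80 : 0 < 8 * C by rewrite mulr_gt0.
  have [m hm] := r_cvg0 (divr_gt0 e0 C80).
  apply: (le_trans (H m)); rewrite mulrC -ler_pdivlMr//; exact: ltW.
pose b := 4 * C * r m.
pose psi a := Num.max (h a - c - b) 0 + Num.min (h a - c + b) 0.
have C00 : 0 < C by exact: C0.
have b0 : 0 < b by rewrite /b !mulr_gt0.
have psi_near a : `|psi a - (h a - c)| <= b.
  rewrite /psi ler_norml.
  by case: (leP (h a - c - b) 0) => h1; case: (leP (h a - c + b) 0) => h2; apply/andP; split; lra.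
suff psic : psi x = psi x'.
  have h1 := psi_near x; have h2 := psi_near x'.
  rewrite (_ : h x - h x' = (psi x' - (h x' - c)) - (psi x - (h x - c))); last by rewrite psic; ring.
  apply: (le_trans (ler_normB _ _)); rewrite /b in h1 h2; lra.
have gC' : \forall n \near U, lip C (g n) by exact: nearW.
have rm2 : 0 < r m / 2 by rewrite divr_gt0.
apply: (scale_induction T_isometry C0 gh hC gC' rm2).
- move=> a a'; rewrite /psi.
  by case: (leP (h a - c - b) 0) => h1; case: (leP (h a - c + b) 0) => h2;
    case: (leP (h a' - c - b) 0) => h3; case: (leP (h a' - c + b) 0) => h4;
    case: (leP 0 (h a - h a')) => h5; lra.
- move=> a a' aa'.
  have [[s sm as_]|far] := pselect (exists2 s, s \in net m & mdist a s <= 7 / 2 * r m).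
    have zero a1 : mdist a1 s <= 4 * r m -> psi a1 = 0.
      move=> a1s; have := hC a1 s; rewrite (hc _ _ sm) => h1.
      have : C * mdist a1 s <= b by rewrite /b -mulrA mulrCA ler_pM2l.
      move=> /(le_trans h1); rewrite /psi ler_norml => /andP[h2 h3].
      by rewrite (max_idPr _) ?(min_idPr _) ?addr0//; lra.
    have := metric_triangle a' a s; rewrite (metric_sym a' a) => h1.
    by have rm := r_gt0 m; rewrite !zero//; lra.
  suff e : h a = h a' by rewrite /psi e.
  apply: (wlim_local T_isometry (ltW C0) gh hC gC' aa').
  apply: filterS (Uoo m) => n mn x1 ax1; apply/eqP/negPn/negP => /g_supp/(reg_decr mn).
  move=> /reg_net [s sm x1s]; apply: far; exists s => //.
  have := metric_triangle a x1 s; have rm := r_gt0 m; lra.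
move=> p q eta eta0; have [n hn] := r_cvg0 (divr_gt0 eta0 (ltr0n R 4)).
apply: filterS (Uoo n) => k nk a a'.
have h1 := g_small k a; have h2 := g_small k a'; have h3 := r_decr nk.
have h4 : 0 <= Num.min (mdist a p) (mdist a q) by rewrite le_min !mdist_ge0.
have h5 : 0 <= Num.min (mdist a' p) (mdist a' q) by rewrite le_min !mdist_ge0.
have h6 := mulr_ge0 (ltW C0) (addr_ge0 h4 h5).
apply: (le_trans (ler_normB _ _)); lra.
Qed.

End Core.

Section FiniteControl.
Context {R : realType} {M : metricType R} (x0 : M) {F : normedModType R}.
Variable T : {linear Lip0 x0 -> dual F}.
Hypothesis T_isometry : forall f, `|T f| = `|f|.
Hypothesis T_surjective : forall phi : dual F, exists f, T f = phi.
Hypothesis Mcomplete : complete_metric M.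

(** Otherwise [cutoff_sequence] provides, for each [n], the convex nonempty set
    [K n] of functions that are supported in the [n]-th region, small,
    uniformly Lipschitz, and on which [y] acts substantially. Members with
    small variation along the cut points of all pairs of points of the first
    nets have a constant limit, on which [y] would still act. *)
Lemma finite_control (y : F) (c : R) : 0 < c -> exists S : seq M, forall f,
  lip 1 f -> {in S, forall s, f s = 0} -> action T y f < c.
Proof.
move=> c0; apply: contrapT => Hn.
have [|b b0 esc1] := bounded_escape T_isometry T_surjective (y := y) c0.
  move=> S; apply: contrapT => HS; apply: Hn; exists S => f f1 fS.
  by rewrite ltNge; apply/negP => hc; apply: HS; exists f.
have c20 : 0 < c / 2 by rewrite divr_gt0.
have [W [net [WS W01 Wlip Wesc]]] :=
  cutoff_sequence T_isometry T_surjective c20 b0 esc1.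
have r2 n : radius n * 2 ^+ n.+1 = 2.
  by rewrite /radius exprVn exprS mulrCA mulVf ?mulr1// expf_neq0.
pose reg n := [set a | W n.+1 a != 0].
have W_decr m n a : (m <= n)%N -> W n a != 0 -> W m a != 0.
  move=> /subnKC <-; elim: (n - m)%N => [|k IH]; first by rewrite addn0.
  by rewrite addnS WS mulf_eq0 negb_or => /andP[/IH].
have reg_decr m n : (m <= n)%N -> reg n `<=` reg m.
  by move=> mn a; apply: W_decr.
have reg_net n a : reg n a -> exists2 x, x \in net n & mdist a x <= 2 * radius n.
  rewrite /reg /= WS mulf_eq0 negb_or => /andP[_].
  exact/tents_support/radius_gt0.
(* the Lipschitz constant of W n.+1 * f is 1 + (2 * 2^-n) * 2^n.+1 = 5 *)
pose K n := [set f : M -> R | [/\ lip 5 f, forall a, f a != 0 -> reg n a,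
  forall a, `|f a| <= 2 * radius n & c / 2 / 2 <= action T y f]].
have Kmid n f g : K n f -> K n g -> K n (fun x => (f x + g x) / 2).
  move=> [f1 f2 f3 f4] [g1 g2 g3 g4].
  have e : (fun x => (f x + g x) / 2) = (fun x => 2^-1 * f x + 2^-1 * g x).
    by apply/funext => x; ring.
  have h2 : `|2^-1 : R| = 2^-1 by rewrite ger0_norm// invr_ge0.
  have hf := lipZ 2^-1 f1; have hg := lipZ 2^-1 g1.
  have e5 : (5 : R) = `|2^-1| * 5 + `|2^-1| * 5 by rewrite h2; field.
  have ez k : lip 5 k -> action T y (fun x => 2^-1 * k x) = 2^-1 * action T y k.
    move=> k5; have := action_linear T y 2^-1 k5 (lip_cst 0 (lexx 0)).
    rewrite (@action_cst _ _ _ _ T T_isometry y (fun=> 0)) // addr0 => <-.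
    congr (action T y _).
    by apply/funext => x; rewrite addr0.
  rewrite e; split.
  - by rewrite e5; exact: lipD.
  - move=> a nz; apply: contrapT => na; move/negP: nz; apply.
    have -> : f a = 0 by apply/eqP/negPn/negP => /f2.
    have -> : g a = 0 by apply/eqP/negPn/negP => /g2.
    by rewrite mulr0 addr0.
  - move=> a; rewrite -mulrDr normrM h2.
    have := ler_normD (f a) (g a); have := f3 a; have := g3 a; lra.
  - rewrite (actionD T y hf hg) !ez//; lra.
have Kdecr m n : (m <= n)%N -> K n `<=` K m.
  move=> mn f [f1 f2 f3 f4]; split => //.
    by move=> a /f2; exact: reg_decr.
  move=> a; apply: (le_trans (f3 a)); rewrite ler_pM2l//; exact: radius_decr.
have K0 n : K n !=set0.
  have [f [f1 _ f0 fc]] := Wesc n.+1 (net n).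
  have fsmall a : W n.+1 a != 0 -> `|f a| <= 2 * radius n.
    move=> /reg_net [s sn as_]; have := f1 a s; rewrite (f0 s sn) subr0 mul1r.
    by move=> /le_trans; apply.
  have W1 x : `|W n.+1 x| <= 1 by have /andP[? ?] := W01 n.+1 x; rewrite ger0_norm.
  exists (fun x => W n.+1 x * f x); split => //.
  - have -> : (5 : R) = 1 + 2 * radius n * 2 ^+ n.+1 by rewrite -mulrA r2; ring.
    by apply: lip_mul => //; rewrite ?exprn_ge0// mulr_ge0// (ltW (radius_gt0 n)).
  - by move=> a; rewrite mulf_eq0 negb_or => /andP[].
  - move=> a; have [->|Wa] := eqVneq (W n.+1 a) 0.
      by rewrite mul0r normr0 mulr_ge0// (ltW (radius_gt0 n)).
    by rewrite normrM -[leRHS]mul1r ler_pM// fsmall.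
pose pts n := flatten [seq net m | m <- iota 0 n.+1].
pose pairs n := [seq (p, q) | p <- pts n, q <- pts n].
have Klip n f : K n f -> lip 5 f by case.
have Ksmall n f : K n f -> forall x, `|f x| <= 2 * radius n by case.
have /choice[g hg] n : exists f, K n f /\
    forall p q, (p, q) \in pairs n -> p != q -> forall s : seq R, path <=%R 0 s ->
      {in s, forall t, cut_levels p q t} ->
      chain_variation (fun t => f (cut_at p q t)) 0 s <= radius n.
  have [f Kf Hf] := small_variation_pairs (ler0n R 5) radius_decr radius_cvg0 (pairs n)
    Kmid Kdecr K0 Klip Ksmall n (radius_gt0 n).
  by exists f.
have gC n : lip 5 (g n) by have [[]] := hg n.
have [U [UU Usub]] := @ultraFilterLemma _ _ eventually_filter.
have Uoo n : \forall k \near U, (n <= k)%N by apply: Usub; exact: nbhs_infty_ge.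
have C0 : (0 : R) < 5 by rewrite ltr0n.
have gC' : \forall n \near U, lip 5 (g n) by exact: nearW.
have [h [hC _ gh]] := wlim_exists T_isometry T_surjective UU (ltW C0) gC'.
have g_supp n a : g n a != 0 -> reg n a by have [[_ H _ _] _] := hg n; exact: H.
have g_small n a : `|g n a| <= 2 * radius n by have [[_ _ H _] _] := hg n; exact: H.
have hpq m k p q : p \in net m -> q \in net k -> h p = h q.
  move=> pm qk; have [->//|pq] := eqVneq p q.
  apply: (wlim_cut_pair T_isometry T_surjective Mcomplete Uoo radius_gt0 radius_decr radius_cvg0
    radius_sum reg_decr reg_net C0 gh hC gC g_supp g_small pq (n0 := maxn m k)).
  move=> n s; rewrite geq_max => /andP[mn kn] ps Ts.
  apply: (hg n).2 => //; apply/allpairsP; exists (p, q); split => //=.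
    by apply/flattenP; exists (net m) => //; apply: map_f; rewrite mem_iota add0n ltnS.
  by apply/flattenP; exists (net k) => //; apply: map_f; rewrite mem_iota add0n ltnS.
have h_net : exists d, forall n x, x \in net n -> h x = d.
  have [[m [p pm]]|none] := pselect (exists m p, p \in net m).
    by exists (h p) => n x xn; exact: hpq xn pm.
  by exists 0 => n x xn; case: none; exists n, x.
have hcst : forall x x', h x = h x'.
  exact: (wlim_constant T_isometry Uoo radius_gt0 radius_decr radius_cvg0 reg_decr reg_net C0 gh hC gC g_supp g_small h_net).
have : c / 2 / 2 <= action T y h.
  by apply: (cvgr_to_ge (gh y)); apply: nearW => n; have [[]] := hg n.
by rewrite (action_cst T_isometry _ hcst); lra.
Qed.

End FiniteControl.

(** * Reduction to complete metric spaces *)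

Section Completion.
Context {R : realType} (M : metricType R).

(** A point of the completion is encoded by its distance function on [M], and
    distances become uniform distances. Distance functions may be unbounded, but
    any two of them differ by a bounded function. *)
Definition distance_limit : {pred (M -> R)} :=
  mem [set xi : M -> R | forall e : R, 0 < e ->
    exists x, forall a, `|xi a - mdist a x| <= e].

Record completion := Completion {
  completion_fun :> M -> R;
  completionP : completion_fun \in distance_limit }.

HB.instance Definition _ := [isSub for completion_fun].
HB.instance Definition _ := [Choice of completion by <:].

Implicit Types xi eta : completion.

Lemma completion_approx xi (e : R) : 0 < e ->
  exists x, forall a, `|xi a - mdist a x| <= e.
Proof. by have := completionP xi; rewrite inE; apply. Qed.

Definition completion_dist xi eta : R := sup [set `|xi a - eta a| | a in setT].

Lemma completion_dist_has_sup xi eta : has_sup [set `|xi a - eta a| | a in setT].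
Proof.
have [x hx] := completion_approx xi ltr01; have [y hy] := completion_approx eta ltr01.
split; first by exists `|xi x - eta x|, x.
exists (2 + mdist x y) => _ [a _ <-].
have h1 := hx a; have h2 := hy a; have := lip_mdist a x y; rewrite mul1r.
rewrite (metric_sym x a) (metric_sym y a) => h3.
rewrite (_ : xi a - eta a = (xi a - mdist a x) + (mdist a x - mdist a y) - (eta a - mdist a y)); last by ring.
apply: (le_trans (ler_normB _ _)).
have := ler_normD (xi a - mdist a x) (mdist a x - mdist a y); lra.
Qed.

Lemma completion_dist_ge xi eta a : `|xi a - eta a| <= completion_dist xi eta.
Proof. by apply: (ub_le_sup (completion_dist_has_sup xi eta).2); exists a. Qed.

Lemma completion_dist_le xi eta c : (forall a, `|xi a - eta a| <= c) ->
  completion_dist xi eta <= c.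
Proof.
move=> H; apply: ge_sup; first exact: (completion_dist_has_sup xi eta).1.
by move=> _ [a _ <-].
Qed.

Lemma completion_dist_ge0 xi eta : 0 <= completion_dist xi eta.
Proof.
have [x _] := completion_approx xi ltr01.
exact: le_trans (normr_ge0 _) (completion_dist_ge xi eta x).
Qed.

Lemma completion_distxx xi : completion_dist xi xi = 0.
Proof.
apply/eqP; rewrite eq_le completion_dist_ge0 andbT.
by apply: completion_dist_le => a; rewrite subrr normr0.
Qed.

Lemma completion_dist_positivity xi eta : completion_dist xi eta = 0 -> xi = eta.
Proof.
move=> e; apply: val_inj; apply/funext => a /=; apply/eqP.
by rewrite -subr_eq0 -normr_le0 -e completion_dist_ge.
Qed.

Lemma completion_dist_sym xi eta : completion_dist xi eta = completion_dist eta xi.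
Proof.
by apply/eqP; rewrite eq_le; apply/andP; split; apply: completion_dist_le => a;
  rewrite distrC completion_dist_ge.
Qed.

Lemma completion_dist_triangle eta xi zeta :
  completion_dist xi zeta <= completion_dist xi eta + completion_dist eta zeta.
Proof.
apply: completion_dist_le => a; apply: (le_trans (ler_distD (eta a) _ _)).
by rewrite lerD ?completion_dist_ge.
Qed.

HB.instance Definition _ := @isMetric.Build R completion completion_dist
  completion_distxx completion_dist_positivity completion_dist_sym completion_dist_triangle.

Lemma embed_subproof (x : M) : (fun a => mdist a x) \in distance_limit.
Proof.
by rewrite inE => e e0; exists x => a; rewrite subrr normr0 ltW.
Qed.

Definition embed (x : M) : completion := Completion (embed_subproof x).

Lemma embed_isometry x y : mdist (embed x) (embed y) = mdist x y.
Proof.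
apply/eqP; rewrite eq_le; apply/andP; split.
  apply: completion_dist_le => a /=; have := lip_mdist a x y.
  by rewrite mul1r (metric_sym x a) (metric_sym y a).
have := completion_dist_ge (embed x) (embed y) y.
by rewrite /= mdistxx subr0 (metric_sym y x) ger0_norm ?mdist_ge0.
Qed.

Lemma embed_dense xi (e : R) : 0 < e -> exists x, mdist xi (embed x) <= e.
Proof.
move=> /(completion_approx xi) [x hx]; exists x.
exact: completion_dist_le.
Qed.

Lemma completion_complete : complete_metric completion.
Proof.
move=> x xC.
have [U [UU Usub]] := @ultraFilterLemma _ _ eventually_filter.
have Uoo n : \forall k \near U, (n <= k)%N by apply: Usub; exact: nbhs_infty_ge.
have [n1 hn1] := xC 1 ltr01.
have /choice[l hl] a : exists l : R, (x k a @[k --> U]) --> l.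
  have [|l hl _] := @ultra_bounded_cvg R nat U (fun k => x k a) (`|x n1 a| + 1) UU; last by exists l.
  apply: filterS (Uoo n1) => k nk.
  have := completion_dist_ge (x n1) (x k) a; have := hn1 n1 k (leqnn _) nk.
  rewrite -[mdist _ _]/(completion_dist _ _) => h1 h2.
  have := ler_normB (x n1 a) (x n1 a - x k a).
  by rewrite (_ : x n1 a - (x n1 a - x k a) = x k a); [lra|ring].
have close (e : R) : 0 < e -> exists n0, forall n a, (n0 <= n)%N -> `|x n a - l a| <= e.
  move=> e0; have [n0 hn0] := xC e e0; exists n0 => n a nn.
  have : (x n a - x k a @[k --> U]) --> x n a - l a.
    by apply: cvgB; [exact: cvg_cst|exact: hl].
  move=> /cvg_norm/cvgr_to_le; apply; apply: filterS (Uoo n0) => k nk.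
  exact: le_trans (completion_dist_ge (x n) (x k) a) (ltW (hn0 _ _ nn nk)).
have lP : l \in distance_limit.
  rewrite inE => e e0; have e2 : 0 < e / 2 by rewrite divr_gt0.
  have [n0 hn0] := close _ e2; have [z hz] := completion_approx (x n0) e2.
  exists z => a; have h1 := hn0 n0 a (leqnn _); have h2 := hz a.
  rewrite (_ : l a - _ = (x n0 a - mdist a z) - (x n0 a - l a)); last by ring.
  by apply: (le_trans (ler_normB _ _)); lra.
exists (Completion lP) => e e0.
have e2 : 0 < e / 2 by rewrite divr_gt0.
have [n0 hn0] := close _ e2; exists n0 => n nn.
apply: (@le_lt_trans _ _ (e / 2)); last by lra.
by apply: completion_dist_le => a; exact: hn0.
Qed.

(** McShane's formula. *)
Lemma lip_extension (k : R) (f : M -> R) : 0 <= k -> lip k f ->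
  exists2 fx : completion -> R, lip k fx & forall x, fx (embed x) = f x.
Proof.
move=> k0 fk.
pose B xi := [set f x + k * mdist xi (embed x) | x in setT].
have Blb xi : has_lbound (B xi).
  have [x hx] := embed_dense xi ltr01.
  exists (f x - k * mdist xi (embed x)) => _ [y _ <-].
  have := fk x y; rewrite ler_norml -embed_isometry => /andP[_].
  have := ler_wpM2l k0 (metric_triangle (embed x) xi (embed y)).
  by rewrite (metric_sym (embed x) xi) mulrDr; lra.
have B0 xi : B xi !=set0.
  by have [x _] := embed_dense xi ltr01; exists (f x + k * mdist xi (embed x)), x.
exists (fun xi => inf (B xi)).
  apply: lip_one_sided => xi eta; rewrite lerBlDr -lerBlDl.
  apply: lb_le_inf => // _ [x _ <-]; rewrite lerBlDl.
  have : inf (B xi) <= f x + k * mdist xi (embed x) by apply: ge_inf => //; exists x.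
  have := ler_wpM2l k0 (metric_triangle xi eta (embed x)); rewrite mulrDr; lra.
move=> x; apply/eqP; rewrite eq_le; apply/andP; split.
  by apply: ge_inf => //; exists x => //; rewrite mdistxx mulr0 addr0.
apply: lb_le_inf => // _ [y _ <-]; rewrite embed_isometry.
by have := fk x y; rewrite ler_norml => /andP[_]; lra.
Qed.

Variable x0 : M.

Lemma dense_restriction_subproof (f : Lip0 (embed x0)) :
  (fun x => f (embed x) : R^o) \in lipschitz_vanishing x0.
Proof.
rewrite inE; split; first exact: Lip0_base.
have [k hk] := Lip0_lipschitz f; exists k => x y.
by rewrite -embed_isometry; exact: hk.
Qed.

Definition dense_restriction (f : Lip0 (embed x0)) : Lip0 x0 := MkLip0 (dense_restriction_subproof f).

Lemma dense_restriction_linear : linear dense_restriction.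
Proof. by move=> a f g; apply: val_inj; apply/funext. Qed.

HB.instance Definition _ := GRing.isLinear.Build R (Lip0 (embed x0)) (Lip0 x0) *:%R
  dense_restriction dense_restriction_linear.

Lemma dense_restriction_isometry f : `|dense_restriction f| = `|f|.
Proof.
apply/eqP; rewrite eq_le; apply/andP; split.
  apply: norm_of_lip => // x y; rewrite -embed_isometry.
  exact: (lip_of_norm (lexx `|f|) (embed x) (embed y)).
apply: norm_of_lip => // xi eta; set L := `|dense_restriction f|.
have L0 : 0 <= L by exact: normr_ge0.
have fL : lip `|f| f by exact: lip_of_norm.
have rL : lip L (dense_restriction f) by exact: lip_of_norm.
apply/ler_addgt0Pr => /= e e0.
pose d := e / (2 * (L + `|f| + 1)).
have K0 : 0 < L + `|f| + 1 by have : 0 <= `|f| by []; lra.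
have d0 : 0 < d by rewrite divr_gt0// mulr_gt0.
have [x hx] := embed_dense xi d0; have [y hy] := embed_dense eta d0.
have dK : 2 * ((L + `|f| + 1) * d) = e by rewrite /d; field; rewrite gt_eqF.
have n0 : 0 <= `|f| by [].
have h1 := le_trans (fL xi (embed x)) (ler_wpM2l n0 hx).
have h2 := le_trans (fL eta (embed y)) (ler_wpM2l n0 hy).
have h3 := rL x y; rewrite /= -embed_isometry in h3.
have h4 : mdist (embed x) (embed y) <= mdist xi eta + 2 * d.
  have := metric_triangle (embed x) xi (embed y); have := metric_triangle xi eta (embed y).
  by rewrite (metric_sym (embed x) xi); lra.
have h5 := ler_wpM2l L0 h4.
rewrite (_ : f xi - f eta = (f xi - f (embed x)) + (f (embed x) - f (embed y)) - (f eta - f (embed y))); last by ring.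
apply: (le_trans (ler_normB _ _)).
have := ler_normD (f xi - f (embed x)) (f (embed x) - f (embed y)).
by move: (`|f|) n0 h1 h2 K0 d0 dK h5 h3 => nf *; lra.
Qed.

Lemma dense_restriction_surjective f : exists g, dense_restriction g = f.
Proof.
have fL : lip `|f| f by exact: lip_of_norm.
have [g gL ge] := lip_extension (normr_ge0 f) fL.
have gP : (g : completion -> R^o) \in lipschitz_vanishing (embed x0).
  by rewrite inE; split; [rewrite ge Lip0_base|exists `|f|].
by exists (MkLip0 gP); apply: val_inj; apply/funext => x /=; exact: ge.
Qed.

End Completion.

(** * Approximation by combinations of evaluations *)

Section FiniteHahnBanach.
Context {R : realType} {M : metricType R} (x0 : M).

(** One point of [S] is removed at a time by the one-dimensional step of the
    Hahn-Banach theorem: the coefficient [a] of the evaluation at [s] has to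
    separate the lower bounds [psi f - c * `|f|] from the upper bounds
    [psi g + c * `|g|] over the functions with value 1 at [s]. *)
Lemma finite_hahn_banach (S : seq M) (c : R) : 0 <= c ->
  forall psi : Lip0 x0 -> R,
  (forall a f g, psi (a *: f + g) = a * psi f + psi g) ->
  (forall f : Lip0 x0, {in S, forall s, f s = 0} -> psi f <= c * `|f|) ->
  exists w : seq (R * M), forall f : Lip0 x0,
    psi f - \sum_(p <- w) p.1 * f p.2 <= c * `|f|.
Proof.
move=> c0; elim: S => [|s S IH] psi psilin H.
  by exists [::] => f; rewrite big_nil subr0; apply: H => x; rewrite in_nil.
have psiZ a f : psi (a *: f) = a * psi f.
  have psi0 : psi 0 = 0.
    by have := psilin (-1) 0 0; rewrite scaler0 addr0 mulN1r addNr.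
  by rewrite -[a *: f]addr0 psilin psi0 addr0.
have psiB f g : psi (f - g) = psi f - psi g.
  by rewrite addrC -scaleN1r psilin mulN1r addrC.
have valZ a (f : Lip0 x0) x : (a *: f) x = a * f x by [].
have valB (f g : Lip0 x0) x : (f - g) x = f x - g x by [].
pose B := [set psi f - c * `|f| | f in [set f : Lip0 x0 |
  {in S, forall s, f s = 0} /\ f s = 1]].
suff [a ha] : exists a, forall f : Lip0 x0, {in S, forall s, f s = 0} ->
    psi f - a * f s <= c * `|f|.
  have [||w hw] := IH (fun f => psi f - a * f s).
  - move=> b f g; transitivity (b * psi f + psi g - a * (b * f s + g s)); last by ring.
    by rewrite psilin.
  - exact: ha.
  by exists ((a, s) :: w) => f; rewrite big_cons /= opprD addrA.
have [B0|/set0P[_ [e [eS es] _]]] := eqVneq B set0.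
  exists 0 => f fS; rewrite mul0r subr0; apply: H => x.
  rewrite inE => /orP[/eqP ->|/fS//]; apply/eqP/negPn/negP => fs.
  suff : B (psi ((f s)^-1 *: f) - c * `|(f s)^-1 *: f|) by rewrite B0.
  exists ((f s)^-1 *: f) => //; split; last by rewrite valZ mulVf.
  by move=> t tS; rewrite valZ (fS t tS) mulr0.
have Bub (g : Lip0 x0) : {in S, forall s, g s = 0} -> g s = 1 -> ubound B (psi g + c * `|g|).
  move=> gS gs _ [f [fS fs] <-].
  have : psi (f - g) <= c * `|f - g|.
    apply: H => x; rewrite inE valB => /orP[/eqP ->|xS]; first by rewrite fs gs subrr.
    by rewrite (fS x xS) (gS x xS) subrr.
  have := ler_wpM2l c0 (ler_normB f g); rewrite psiB mulrDr; lra.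
have Bhas : has_ubound B by exists (psi e + c * `|e|); exact: Bub.
have Bne : B !=set0 by exists (psi e - c * `|e|), e.
exists (sup B) => f fS.
have [fs|fs|fs] := ltgtP (f s) 0.
- have nf : f s != 0 by rewrite lt_eqF.
  have : sup B <= psi ((f s)^-1 *: f) + c * `|(f s)^-1 *: f|.
    apply: ge_sup => //; apply: Bub; last by rewrite valZ mulVf.
    by move=> t tS; rewrite valZ (fS t tS) mulr0.
  rewrite psiZ normrZ normfV (ltr0_norm fs) => h.
  have := ler_wnM2r (ltW fs) h.
  rewrite mulrDl mulrAC mulVf// mul1r.
  have -> : c * ((- f s)^-1 * `|f|) * f s = - (c * `|f|).
    by field; rewrite ?oppr_eq0.
  lra.
- have nf : f s != 0 by rewrite gt_eqF.
  have : psi ((f s)^-1 *: f) - c * `|(f s)^-1 *: f| <= sup B.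
    apply: ub_le_sup => //; exists ((f s)^-1 *: f) => //; split.
      by move=> t tS; rewrite valZ (fS t tS) mulr0.
    by rewrite valZ mulVf.
  rewrite psiZ normrZ normfV (gtr0_norm fs) => h.
  have := ler_wpM2r (ltW fs) h.
  rewrite mulrBl mulrAC mulVf// mul1r.
  have -> : c * ((f s)^-1 * `|f|) * f s = c * `|f| by field.
  lra.
- rewrite fs mulr0 subr0; apply: H => x; rewrite inE => /orP[/eqP -> //|].
  exact: fS.
Qed.

End FiniteHahnBanach.

Section CompleteApproximation.
Context {R : realType} {M : metricType R} (x0 : M) {F : normedModType R}.
Variable T : {linear Lip0 x0 -> dual F}.
Hypothesis T_isometry : forall f, `|T f| = `|f|.
Hypothesis T_surjective : forall phi : dual F, exists f, T f = phi.

Lemma finite_approximation (y : F) (c : R) : complete_metric M -> 0 < c ->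
  exists w : seq (R * M), forall f : Lip0 x0,
    `|T f y - \sum_(p <- w) p.1 * f p.2| <= c * `|f|.
Proof.
move=> Mcomplete c0.
have [S hS] := finite_control T_isometry T_surjective Mcomplete y c0.
have [|f fS|w hw] := @finite_hahn_banach R M x0 S c (ltW c0) (fun f => T f y).
- by move=> a f g; rewrite linearP.
- have [f0|f0] := eqVneq `|f| 0.
    by move/normr0_eq0: (f0) => ->; rewrite linear0 normr0 mulr0.
  have fpos : 0 < `|f| by rewrite lt_neqAle eq_sym f0 normr_ge0.
  pose k := `|f|^-1 *: f.
  have k1 : lip 1 k.
    by apply: lip_of_norm; rewrite normrZ normfV normr_id mulVf.
  have kS : {in S, forall s, k s = 0}.
    by move=> s sS; rewrite -[k s]/(`|f|^-1 * f s) (fS s sS) mulr0.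
  have := hS k k1 kS; rewrite /action anchor_id linearZ /=.
  rewrite -[X in X < _]/(`|f|^-1 * T f y) mulrC ltr_pdivrMr// => /ltW.
  by [].
exists w => f; rewrite ler_norml hw andbT.
have := hw (- f); rewrite normrN.
rewrite linearN -[X in X - _]/(- T f y).
have -> : \sum_(p <- w) p.1 * (- f : Lip0 x0) p.2 = - \sum_(p <- w) p.1 * f p.2.
  by rewrite -sumrN; apply: eq_bigr => p _; rewrite -[(- f : Lip0 x0) p.2]/(- f p.2) mulrN.
lra.
Qed.

End CompleteApproximation.

Section Approximation.
Context {R : realType} {M : metricType R} (x0 : M) {F : normedModType R}.
Variable T : {linear Lip0 x0 -> dual F}.
Hypothesis T_isometry : forall f, `|T f| = `|f|.
Hypothesis T_surjective : forall phi : dual F, exists f, T f = phi.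

(** The evaluations at points of the completion are moved to nearby points of
    [M]. *)
Lemma evaluation_approximation (y : F) (c : R) : 0 < c ->
  exists w : seq (R * M), forall f : Lip0 x0,
    `|T f y - \sum_(p <- w) p.1 * f p.2| <= c * `|f|.
Proof.
move=> c0.
pose T' : {linear Lip0 (embed x0) -> dual F} := T \o @dense_restriction R M x0.
have T'iso f : `|T' f| = `|f| by rewrite /T' /= T_isometry dense_restriction_isometry.
have T'sur phi : exists f, T' f = phi.
  have [f <-] := T_surjective phi; have [g <-] := dense_restriction_surjective f.
  by exists g.
have c2 : 0 < c / 2 by rewrite divr_gt0.
have [w hw] := finite_approximation T'iso T'sur y (@completion_complete R M) c2.
have [w' hw'] : exists w' : seq (R * M), forall f : Lip0 (embed x0),
    `|\sum_(p <- w) p.1 * f p.2 - \sum_(p <- w') p.1 * f (embed p.2)| <= c / 2 * `|f|.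
  elim: w (c / 2) c2 {hw} => [|[a xi] w IH] d d0.
    by exists [::] => f; rewrite !big_nil subrr normr0 mulr_ge0// ltW.
  have d2 : 0 < d / 2 by rewrite divr_gt0.
  have [w' hw'] := IH _ d2.
  have a0 : 0 < `|a| + 1 by have : 0 <= `|a| by []; lra.
  have [x hx] := embed_dense xi (divr_gt0 d2 a0).
  exists ((a, x) :: w') => f; rewrite !big_cons /= opprD addrACA.
  apply: (le_trans (ler_normD _ _)); rewrite (splitr d) mulrDl lerD//.
  rewrite -mulrBr normrM.
  have fL : lip `|f| f by exact: lip_of_norm.
  have h1 := le_trans (fL xi (embed x)) (ler_wpM2l (normr_ge0 f) hx).
  apply: (le_trans (ler_wpM2l (normr_ge0 a) h1)).
  have -> : `|a| * (`|f| * (d / 2 / (`|a| + 1))) = d / 2 * `|f| * (`|a| / (`|a| + 1)).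
    by ring.
  apply: ler_piMr; first by rewrite mulr_ge0// ltW.
  by rewrite ler_pdivrMr// mul1r lerDl.
exists w' => f; have [g gf] := dense_restriction_surjective f.
have := hw g; have := hw' g.
rewrite -[T' g]/(T (dense_restriction g)) -(dense_restriction_isometry g) gf.
have -> : \sum_(p <- w') p.1 * g (embed p.2) = \sum_(p <- w') p.1 * f p.2.
  by apply: eq_bigr => p _; rewrite -gf.
set A := \sum_(p <- w) _; set B := \sum_(p <- w') _ => h1 h2.
have := ler_normD (T f y - A) (A - B); rewrite addrA subrK; lra.
Qed.

End Approximation.

Section Span.
Context {R : realType} {M : metricType R} (x0 : M).

Definition combination (w : seq (R * M)) : dual (Lip0 x0) :=
  \sum_(i < size w) (tnth (in_tuple w) i).1 *: delta x0 (tnth (in_tuple w) i).2.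

Lemma combination_span w : linear_span (range (delta x0)) (combination w).
Proof.
exists (size w), (fun i => (tnth (in_tuple w) i).1), (fun i => delta x0 (tnth (in_tuple w) i).2).
by split => // i; exists (tnth (in_tuple w) i).2.
Qed.

Lemma combinationE w (f : Lip0 x0) : combination w f = \sum_(p <- w) p.1 * f p.2.
Proof.
rewrite /combination (big_morph (fun nu : dual (Lip0 x0) => nu f) (id1 := 0) (op1 := +%R))//.
by rewrite [RHS]big_tnth.
Qed.

End Span.

Theorem theorem1p1 (R : realType) (M : metricType R) (x0 : M)
  (F : completeNormedModType R) (T : {linear Lip0 x0 -> dual F})
  (T_isometry : forall f : Lip0 x0, `|T f| = `|f|)
  (T_surjective : forall phi : dual F, exists f : Lip0 x0, T f = phi) :
  continuous (T : sigma_topology (Lip0_pairing x0) -> sigma_topology (dual_pairing F)).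
Proof.
apply: sigma_continuous => y.
have phiP : ((fun f => T f y) : Lip0 x0 -> R^o) \in @continuous_functional R (Lip0 x0).
  rewrite inE; split; first by move=> a f g; rewrite linearP.
  pose L : {linear Lip0 x0 -> R^o} := HB.pack ((fun f => T f y) : Lip0 x0 -> R^o)
    (GRing.isLinear.Build R (Lip0 x0) R^o *:%R ((fun f => T f y) : Lip0 x0 -> R^o)
      (fun a f g => congr1 (fun k : dual F => k y) (linearP T a f g))).
  apply: (@bounded_linear_continuous _ _ _ L); apply/linear_boundedP.
  exists `|y|; split; first exact: num_real.
  move=> k yk f; rewrite /= (le_trans (dual_norm_le _ _))//.
  rewrite -[dual_norm _]/(`|T f|) T_isometry mulrC ler_wpM2r// ltW//.
pose phi := Dual phiP.
have phi_free : free_space x0 phi.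
  move=> B /nbhs_ballP[e /= e0 eB]; have e2 : 0 < e / 2 by rewrite divr_gt0.
  have [w hw] := evaluation_approximation T_isometry T_surjective y e2.
  exists (combination x0 w); split; first exact: combination_span.
  apply: eB; rewrite -ball_normE /ball_ /=.
  apply: (@le_lt_trans _ _ (e / 2)); last by rewrite ltr_pdivrMr// ltr_pMr// ltr1n.
  apply: dual_norm_ge; first exact: ltW.
  move=> f; have := hw f; rewrite -combinationE.
  by apply: le_trans.
pose mu : free_space x0 := SigSub (mem_set phi_free).
exact: (@sigma_pairing_continuous R (Lip0 x0) (free_space x0) (Lip0_pairing x0) mu).
Qed.
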